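(* There is an absolute constant $c>0$ such that the following holds. Let $P\subseteq\mathbb{Z}$ with $|P|=4$, and suppose $P$ is not of the form $P=\{k_0,k_1,k_2,k_3\}$ with integers $k_0<k_1<k_2<k_3$ and $k_0+k_3=k_1+k_2$. Then $\mathsf{pdd}_P(\alpha)<(1-c)\alpha^4$ for all $0<\alpha<1/2$.
   Context: Let $[N]=\{1,\dots,N\}$. For a finite $P\subseteq\mathbb{Z}^r$ and $0<\alpha<1$, the popular difference density $\mathsf{pdd}_P(\alpha)$ is the largest real number such that for every $\epsilon>0$ there exists $N_0=N_0(P,\epsilon)$ such that for every $N\ge N_0$ and every $A\subseteq[N]^r$ with $|A|\ge\alpha N^r$ there is some nonzero integer $d$ with $|\{x\in\mathbb{Z}^r : x+dy\in A \text{ for all } y\in P\}|\ge(\mathsf{pdd}_P(\alpha)-\epsilon)N^r$. *)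

(* Defs.v *)
From mathcomp Require Import all_boot all_order all_algebra finmap.
From mathcomp Require Import all_classical all_reals.

Set Implicit Arguments.
Unset Strict Implicit.
Unset Printing Implicit Defensive.

Import Order.TTheory GRing.Theory Num.Theory.
Local Open Scope classical_set_scope.
Local Open Scope ring_scope.

Definition translates (P A : {fset int}) (d : int) : set int :=
  [set x | forall y, y \in P -> x + d * y \in A].

(* [fset_set] sends infinite sets to [fset0]; [translates P A d] is finite as
   soon as P is nonempty, see [finite_translates]. *)
Definition ntranslates (P A : {fset int}) (d : int) : nat :=
  #|` fset_set (translates P A d)|.

Definition popular_density (R : realType) (P : {fset int}) (alpha beta : R)
    : Prop :=
  forall eps : R, 0 < eps ->
  exists N0 : nat, forall N : nat, (N0 <= N)%N ->
  forall A : {fset int},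
    (forall a, a \in A -> 1 <= a <= N%:Z) ->
    alpha * N%:R <= #|` A|%:R ->
  exists d : int, d != 0 /\ (beta - eps) * N%:R <= (ntranslates P A d)%:R.

(* The supremum is a maximum for nonempty P and alpha <= 1: see [pddP]. *)
Definition pdd (R : realType) (P : {fset int}) (alpha : R) : R :=
  sup [set beta : R | popular_density P alpha beta].

Lemma translates_sub (P A : {fset int}) (d y : int) : y \in P ->
  translates P A d `<=` [set` [fset a - d * y | a in A]%fset].
Proof.
move=> yP x /(_ _ yP) xA /=; apply/imfsetP.
by exists (x + d * y) => //; rewrite addrK.
Qed.

Lemma finite_translates (P A : {fset int}) (d : int) : P != fset0 ->
  finite_set (translates P A d).
Proof.
case/fset0Pn => y yP; apply: sub_finite_set (translates_sub yP) _.
exact: finite_fset.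
Qed.

Lemma ntranslates_le (P A : {fset int}) (d : int) : P != fset0 ->
  (ntranslates P A d <= #|` A|)%N.
Proof.
move=> P0; have Pfin := finite_translates A d P0.
case/fset0Pn: P0 => y yP.
apply: (@leq_trans #|` [fset a - d * y | a in A]%fset|).
  apply: fsubset_leq_card; apply/fsubsetP => x.
  by rewrite in_fset_set// inE => /(translates_sub yP).
by rewrite card_imfset//=; exact: addIr.
Qed.

Lemma pddP (R : realType) (P : {fset int}) (alpha : R) :
  P != fset0 -> alpha <= 1 ->
  popular_density P alpha (pdd P alpha) /\
  forall beta, popular_density P alpha beta -> beta <= pdd P alpha.
Proof.
move=> P0 a1; set E := [set beta : R | popular_density P alpha beta].
have E0 : E 0.
  move=> e e0; exists 0%N => N _ A _ _; exists 1; split=> //.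
  by rewrite sub0r (@le_trans _ _ 0)// mulNr oppr_le0 mulr_ge0// ltW.
have ubE : ubound E 2.
  move=> b /(_ 1 ltr01)[N0 /(_ N0.+1 (leqnSn _))].
  pose A : {fset int} := [fset (Posz (nat_of_ord i).+1) | i in 'I_N0.+1]%fset.
  have cA : #|` A| = N0.+1.
    rewrite card_imfset/=; last by move=> i j [] /ord_inj.
    by rewrite -cardE card_ord.
  case/(_ A) => [a /imfsetP[i _ ->]|| d [_ h]].
  - by rewrite -[1]/(Posz 1) !lez_nat ltn_ord.
  - by rewrite cA ler_piMl.
  have := le_trans h (_ : _ <= N0.+1%:R).
  rewrite ler_nat -[X in (_ <= X)%N]cA ntranslates_le// => /(_ isT).
  by rewrite ger_pMl// lerBlDr.
have supE : has_sup E by split; [exists 0 | exists 2].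
split; last by move=> b Eb; apply: (sup_upper_bound supE).
move=> e e0; have e20 : 0 < e / 2 by rewrite divr_gt0.
have [b Eb lb] := sup_adherent e20 supE.
have [N0 hN] := Eb _ e20; exists N0 => N /hN{}hN A AN aA.
have [d [d0 hd]] := hN A AN aA; exists d; split=> //; apply: le_trans hd.
rewrite ler_wpM2r// lerBrDr (le_trans _ (ltW lb))//.
by rewrite {1}(splitr e) opprD addrA subrK.
Qed.

(* Main.v *)
(** Normalise the pattern to [0 < k1 < k2 < k3]. Up to scaling there is one
    vector [c] orthogonal to [1], [k] and [k^2], so that for a quadratic
    polynomial [q] the combination [\sum_j c_j q (x + d k_j)] vanishes for all
    [x] and [d]. Let the density be a constant times [1 + g], with [g] a small
    combination of the characters [e (c_j q (x) + linear terms)]. In the average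
    over [x] of [\prod_j (1 + g (x + d k_j))] only few products of characters
    survive. The product using every [c_j] once survives with phase [0], and its
    coefficient is made negative. Products using the [c_j] in another order may
    survive, with a phase depending on [d]; they are tamed by summing over the
    differences [q_i - q_i'] of [n] polynomials, because
    [|\sum_i u_i|^2 - n >= - n] whatever the phases, while it is [n^2 - n] for
    the main term. The remaining survivors use two indices [u], [v] twice each,
    which forces a multiplicative relation between the gaps of the pattern. Such
    a relation never holds for two complementary pairs of indices, as
    [t^3 = t^2 + 1] has no rational root, and so the amplitudes can be chosen to
    make these terms negligible.

    The polynomials have random coefficients, and for some [d] an equidistribution
    estimate fails. Cutting [[1, N]] into [K] blocks with independent coefficients
    confines each failure to boundedly many blocks, and the patterns meeting two
    blocks are compensated by those lost at the end of the interval. A random set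
    with the resulting density finally has the right number of patterns for all
    [d] simultaneously. *)

From mathcomp Require Import all_boot all_order all_algebra perm cyclic.
From mathcomp Require Import separable cyclotomic zify ring lra complex.
From mathcomp Require Import reals sequences exp.

Set Implicit Arguments.
Unset Strict Implicit.
Unset Printing Implicit Defensive.

Import Order.TTheory GRing.Theory Num.Theory.
Local Open Scope ring_scope.
Local Notation Re := complex.Re.

(** * Resonances between the coefficients of a four-point pattern *)

(** Infinite descent: modulo 2 the equation forces [p] and [q] to be even, and it is homogeneous, so
    both can be halved. *)
Lemma cubic_no_nat_solution (p q : nat) :
  (p ^ 3 = p ^ 2 * q + q ^ 3)%N -> q = 0%N.
Proof.
have [m] := ubnP q; elim: m p q => // m IHm p q lt_qm eq_pq.
have := erefl (odd (p ^ 3)); rewrite {1}eq_pq oddD oddM !oddX /=.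
case op: (odd p); case oq: (odd q) => //= _.
have ep := even_halfK (negbT op); have eq := even_halfK (negbT oq).
have [q0|q_gt0] := posnP q; first by [].
suff : q./2 = 0%N by lia.
apply: (IHm p./2); first by lia.
rewrite -ep -eq in eq_pq; move: eq_pq; rewrite -!muln2; nia.
Qed.

Lemma cubic_no_ratio (t : rat) : 0 < t -> t ^+ 3 != t ^+ 2 + 1.
Proof.
move=> t0; apply/eqP => tE.
have nE : numq t = `|numq t|%N by rewrite gez0_abs// numq_ge0 ltW.
have dE : denq t = `|denq t|%N by rewrite gez0_abs// denq_ge0.
have d0 : (`|denq t|%N)%:R != 0 :> rat by rewrite pnatr_eq0 absz_eq0 denq_neq0.
suff : `|denq t|%N = 0%N by move=> h; rewrite h eqxx in d0.
apply: (@cubic_no_nat_solution `|numq t|%N).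
apply/eqP; rewrite -(eqr_nat rat) natrD natrM !natrX; apply/eqP.
have tq : t = (`|numq t|%N)%:R / (`|denq t|%N)%:R.
  by rewrite -[LHS]divq_num_den {1}nE {1}dE.
have -> : (`|numq t|%N)%:R = t * (`|denq t|%N)%:R by rewrite {2}tq divfK.
by rewrite exprMn tE; ring.
Qed.

Section Ratios.
Variables r1 r2 r3 : rat.
Hypotheses (r2_gt1 : 1 < r2) (r21 : r2 < r1) (r23 : r2 < r3).
Hypothesis rel : (r1 + 1) * (r2 - 1) = (r3 - 1) * (r1 - r2).

(** For gaps [x], [y], [z] with [z < x] the three ratios will be [x / z], [(x + y) / (y + z)] and
    [(x + y + z) / y], the quotients of the two distances in each splitting of the four points into
    pairs. They depend on two parameters only, whence the relation [rel]. *)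
Definition ratio_hit (l m : rat) :=
  m = l * r1 \/ m = l * r2 \/ m = l * r3 \/
  m * r1 = l \/ m * r2 = l \/ m * r3 = l.

Lemma cubic_relation (t : rat) : 1 < t ->
  (t - 1) * (t + 1) * (t ^+ 3 - (t ^+ 2 + 1)) = 0 -> False.
Proof.
move=> t1 /eqP; have t0 : 0 < t by lra.
rewrite !mulf_eq0 (subr_eq0 (t ^+ 3)) (negPf (cubic_no_ratio t0)) orbF.
by move=> /orP[] /eqP; lra.
Qed.

Lemma lt_mul_gt1 (a b : rat) : 1 < a -> 1 < b -> a < a * b /\ b < a * b.
Proof. by move=> a1 b1; split; nra. Qed.

Let r1_gt1 : 1 < r1. Proof. exact: lt_trans r21. Qed.
Let r3_gt1 : 1 < r3. Proof. exact: lt_trans r23. Qed.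

(** Every other alternative equates a number greater than 1 with 1, or a product of two such numbers
    with one of its factors. *)
Lemma ratio_hit1_mul (a b c : rat) : 1 < a -> 1 < b ->
  a * b = 1 * a \/ a * b = 1 * b \/ a * b = 1 * c \/
  a * b * a = 1 \/ a * b * b = 1 \/ a * b * c = 1 -> 1 < c -> c = a * b.
Proof.
move=> a1 b1 h c1; have [ab1 ab2] := lt_mul_gt1 a1 b1.
have ab : 1 < a * b by lra.
have [h1 _] := lt_mul_gt1 ab a1; have [h2 _] := lt_mul_gt1 ab b1.
have [h3 _] := lt_mul_gt1 ab c1.
by case: h => [e|[e|[e|[e|[e|e]]]]]; lra.
Qed.

(** Comparing sizes leaves only [r1 = r2 * r3] and [r3 = r2 ^+ 2]. With [t = r2], hence
    [r3 = t ^+ 2] and [r1 = t ^+ 3], [rel] becomes the equation of [cubic_relation]. *)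
Lemma ratio_split01 : ratio_hit 1 (r2 * r3) -> ratio_hit r2 r3 -> False.
Proof.
have [g1 g2] := (r21, r23); move=> h h'; have e1 : r1 = r2 * r3.
  by apply: ratio_hit1_mul => //; move: h; rewrite /ratio_hit; tauto.
have [a1 a2] := lt_mul_gt1 r2_gt1 r3_gt1.
have [b1 b2] := lt_mul_gt1 r2_gt1 r1_gt1.
have [c1 c2] := lt_mul_gt1 r3_gt1 r1_gt1.
have [d1 d2] := lt_mul_gt1 r3_gt1 r2_gt1.
have [f1 f2] := lt_mul_gt1 r3_gt1 r3_gt1.
case: h' => [e|[e|[e|[e|[e|e]]]]]; try (exfalso; lra).
apply: (cubic_relation r2_gt1); move: rel; rewrite e1 e => rel'.
rewrite -(subrr ((r2 * (r2 * r2) + 1) * (r2 - 1))) {1}rel'; ring.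
Qed.

Lemma ratio_split02 : ratio_hit 1 (r1 * r3) -> False.
Proof.
have g1 := r21; move=> h; have e1 : r2 = r1 * r3.
  by apply: ratio_hit1_mul => //; move: h; rewrite /ratio_hit; tauto.
have [a1 a2] := lt_mul_gt1 r1_gt1 r3_gt1; lra.
Qed.

(** The same cubic appears, now from [r1 = t ^+ 2] and [r3 = t ^+ 3] with [t = r2]. *)
Lemma ratio_split03 : ratio_hit 1 (r1 * r2) -> ratio_hit r2 r1 -> False.
Proof.
have [g1 g2] := (r21, r23); move=> h h'; have e1 : r3 = r1 * r2.
  by apply: ratio_hit1_mul => //; move: h; rewrite /ratio_hit; tauto.
have [a1 a2] := lt_mul_gt1 r2_gt1 r3_gt1.
have [b1 b2] := lt_mul_gt1 r2_gt1 r1_gt1.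
have [c1 c2] := lt_mul_gt1 r1_gt1 r3_gt1.
have [d1 d2] := lt_mul_gt1 r1_gt1 r2_gt1.
have [f1 f2] := lt_mul_gt1 r1_gt1 r1_gt1.
case: h' => [e|[e|[e|[e|[e|e]]]]]; try (exfalso; lra).
apply: (cubic_relation r2_gt1); move: rel; rewrite e1 e => rel'.
rewrite -(subrr ((r2 * r2 + 1) * (r2 - 1))) {1}rel'; ring.
Qed.
End Ratios.

(** Vandermonde determinants of the four points with gaps [x], [y], [z] when the [j]-th point is
    left out. With alternating signs they form the vector orthogonal to 1, [k] and [k^2]. *)
Definition gap_minor (T : pzSemiRingType) (x y z : T) (j : nat) : T :=
  nth 0 [:: y * z * (y + z); (x + y) * (x + y + z) * z;
            x * (x + y + z) * (y + z); x * (x + y) * y] j.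

(** The two distances in each splitting of the four points into two pairs, in both orders. *)
Definition gap_pairs (T : pzSemiRingType) (x y z : T) : seq (T * T) :=
  [:: (x, z); (z, x); (x + y, y + z); (y + z, x + y); (x + y + z, y);
      (y, x + y + z)].

Definition resonant (T : nzSemiRingType) (x y z : T) (u v : nat) : bool :=
  has (fun pq => gap_minor x y z u * pq.1 == gap_minor x y z v * pq.2)
      (gap_pairs x y z).

Lemma resonant_sym (x y z : int) (u v : nat) : resonant x y z u v = resonant x y z v u.
Proof.
suff imp u' v' : resonant x y z u' v' -> resonant x y z v' u'.
  by apply/idP/idP; exact: imp.
case/hasP => -[p q] pq /= /eqP e; apply/hasP; exists (q, p); last by rewrite /= e.
move: pq; rewrite /gap_pairs !inE !xpair_eqE.
by rewrite !(andbC (p == _)); do ![case: eqP => ? //=].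
Qed.

(** Reflection of the pattern, which reduces the case [x < z] to [z < x]. *)
Lemma resonant_rev (x y z : int) (u v : 'I_4) :
  resonant z y x u v = resonant x y z (3 - u) (3 - v).
Proof.
have minE (j : 'I_4) : gap_minor z y x j = gap_minor x y z (3 - j).
  by case: j => [[|[|[|[|//]]]] ?]; rewrite /gap_minor /=; ring.
rewrite /resonant !minE /gap_pairs /= !orbF (addrC z y) (addrC y x).
have -> : y + z + x = x + y + z by ring.
by do ![case: eqP => ? //=].
Qed.

Section Resonance.
Variables x y z : int.
Hypotheses (x_gt0 : 0 < x) (y_gt0 : 0 < y) (z_gt0 : 0 < z).
Hypothesis zx : z < x.
Let X : rat := x%:~R.
Let Y : rat := y%:~R.
Let Z : rat := z%:~R.
Let r1 := X / Z.
Let r2 := (X + Y) / (Y + Z).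
Let r3 := (X + Y + Z) / Y.

(** Here [m / l] is the quotient of the two minors, and a resonance equates it with the quotient of
    the two distances in some splitting. *)
Lemma resonant_ratio_hit (u v : nat) (l m : rat) :
  0 < gap_minor X Y Z u ->
  gap_minor X Y Z v * l = gap_minor X Y Z u * m ->
  resonant x y z u v -> ratio_hit r1 r2 r3 l m.
Proof.
have X0 : 0 < X by rewrite ltr0z.
have Y0 : 0 < Y by rewrite ltr0z.
have Z0 : 0 < Z by rewrite ltr0z.
have XY0 : 0 < X + Y by apply: addr_gt0.
have YZ0 : 0 < Y + Z by apply: addr_gt0.
have S0 : 0 < X + Y + Z by apply: addr_gt0.
move=> u0 lm.
have key (p q : int) : 0 < q%:~R :> rat ->
    gap_minor x y z u * p == gap_minor x y z v * q ->
    m = l * (p%:~R / q%:~R).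
  move=> q0 /eqP pq; apply: (mulfI (lt0r_neq0 u0)).
  have {}pq : gap_minor X Y Z u * p%:~R = gap_minor X Y Z v * q%:~R :> rat.
    have castE w : (gap_minor x y z w)%:~R = gap_minor X Y Z w :> rat.
      rewrite /gap_minor /X /Y /Z.
      by case: w => [|[|[|[|[|w]]]]] //=; rewrite !(rmorphM, rmorphD).
    by rewrite -!castE -!rmorphM /= pq.
  rewrite -lm mulrCA (mulrA (gap_minor X Y Z u)) pq mulfK ?lt0r_neq0 //.
  exact: mulrC.
have inv (a b : rat) : 0 < a -> 0 < b -> m = l * (b / a) -> m * (a / b) = l.
  by move=> a0 b0 ->; field; rewrite !gt_eqF.
have cE : ((x + y)%:~R = X + Y) * ((y + z)%:~R = Y + Z) *
          ((x + y + z)%:~R = X + Y + Z) by rewrite !rmorphD.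
rewrite /resonant /gap_pairs /= orbF /ratio_hit /r1 /r2 /r3.
case/or4P => [h|h|h|/or3P[h|h|h]].
- by left; apply: key.
- by right; right; right; left; apply: inv => //; apply: key.
- by right; left; rewrite -!cE; apply: key; rewrite ?cE.
- right; right; right; right; left; apply: inv => //; rewrite -!cE.
  by apply: key; rewrite ?cE.
- by right; right; left; rewrite -!cE; apply: key; rewrite ?cE.
- right; right; right; right; right; apply: inv => //; rewrite -!cE.
  by apply: key; rewrite ?cE.
Qed.

(** In terms of the ratios, the quotients of minors are [r2 * r3] and [r3 / r2] for the splitting
    01|23, [r1 * r3] for the pair 02, and [r1 * r2] and [r1 / r2] for 03|12. *)
Lemma complementary_not_resonant_lt :
  [/\ ~~ (resonant x y z 0 1 && resonant x y z 2 3), ~~ resonant x y z 0 2 &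
      ~~ (resonant x y z 0 3 && resonant x y z 1 2)].
Proof.
have X0 : 0 < X by rewrite ltr0z.
have Y0 : 0 < Y by rewrite ltr0z.
have Z0 : 0 < Z by rewrite ltr0z.
have ZX : Z < X by rewrite ltr_int.
have XY0 : 0 < X + Y by apply: addr_gt0.
have YZ0 : 0 < Y + Z by apply: addr_gt0.
have S0 : 0 < X + Y + Z by apply: addr_gt0.
have nz := (gt_eqF X0, gt_eqF Y0, gt_eqF Z0, gt_eqF YZ0, gt_eqF XY0, gt_eqF S0).
have r2_gt1 : 1 < r2 by rewrite /r2 ltr_pdivlMr // mul1r; lra.
have r21 : r2 < r1.
  by rewrite /r2 /r1 ltr_pdivrMr // mulrAC ltr_pdivlMr //; nra.
have r23 : r2 < r3.
  by rewrite /r2 /r3 ltr_pdivrMr // mulrAC ltr_pdivlMr //; nra.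
have rel : (r1 + 1) * (r2 - 1) = (r3 - 1) * (r1 - r2).
  by rewrite /r1 /r2 /r3; field; rewrite !nz.
have pos j : (j < 4)%N -> 0 < gap_minor X Y Z j.
  by case: j => [|[|[|[|//]]]] _; rewrite /gap_minor /= !mulr_gt0.
split.
- apply/negP => /andP[h01]; rewrite resonant_sym => h32.
  apply: (ratio_split01 r2_gt1 r21 r23 rel).
    apply: (resonant_ratio_hit _ _ h01); first exact: pos.
    by rewrite /gap_minor /r2 /r3 /=; field; rewrite !nz.
  apply: (resonant_ratio_hit _ _ h32); first exact: pos.
  by rewrite /gap_minor /r2 /r3 /=; field; rewrite !nz.
- apply/negP => h02; apply: (ratio_split02 r2_gt1 r21 r23).
  apply: (resonant_ratio_hit _ _ h02); first exact: pos.
  by rewrite /gap_minor /r1 /r3 /=; field; rewrite !nz.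
- apply/negP => /andP[h03 h12]; apply: (ratio_split03 r2_gt1 r21 r23 rel).
    apply: (resonant_ratio_hit _ _ h03); first exact: pos.
    by rewrite /gap_minor /r1 /r2 /=; field; rewrite !nz.
  apply: (resonant_ratio_hit _ _ h12); first exact: pos.
  by rewrite /gap_minor /r1 /r2 /=; field; rewrite !nz.
Qed.
End Resonance.

Lemma complementary_not_resonant (x y z : int) :
  0 < x -> 0 < y -> 0 < z -> x != z ->
  [/\ ~~ (resonant x y z 0 1 && resonant x y z 2 3),
      ~~ (resonant x y z 0 2 && resonant x y z 1 3) &
      ~~ (resonant x y z 0 3 && resonant x y z 1 2)].
Proof.
move=> x0 y0 z0; case: (ltgtP z x) => // [zx|xz] _.
  have [h1 h2 h3] := complementary_not_resonant_lt x0 y0 z0 zx.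
  by split=> //; rewrite negb_and h2.
have [] := complementary_not_resonant_lt z0 y0 x0 xz.
have rv u v : (u < 4)%N -> (v < 4)%N ->
    resonant z y x u v = resonant x y z (3 - u) (3 - v).
  by move=> u4 v4; exact: (resonant_rev x y z (Ordinal u4) (Ordinal v4)).
rewrite !rv // -[(3 - 0)%N]/3%N -[(3 - 1)%N]/2%N -[(3 - 2)%N]/1%N -[(3 - 3)%N]/0%N.
move=> h1 h2 h3.
split.
- by rewrite andbC resonant_sym (resonant_sym _ _ _ 0).
- by rewrite negb_and [in X in _ || X]resonant_sym h2 orbT.
- by rewrite resonant_sym (resonant_sym _ _ _ 1).
Qed.

(** A product using [u] and [v] twice each has amplitude [(a u * a v) ^+ 2]; for a resonant pair
    this must be at most [e] times the amplitude of the main term. The lower bound [e ^+ 3] keeps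
    the main term above a constant common to all patterns. *)
Definition amplitude_ok (R : realFieldType) (e : R) (res : rel nat)
    (a : nat -> R) :=
  [/\ forall j, 0 < a j <= 1, e ^+ 3 <= \prod_(j < 4) a j &
   forall u v : 'I_4, u != v -> res u v ->
     (a u * a v) ^+ 2 <= e * \prod_(j < 4) a j].

(* One amplitude [e] against three [1], or one [1] against three [e]: the
   eight possibilities realise every choice of the smaller product in the
   three splittings of the indices into two pairs. *)
Lemma amplitudes_exist (R : realFieldType) (e : R) (res : rel nat) :
  0 < e <= 1 -> symmetric res ->
  ~~ (res 0 1 && res 2 3)%N -> ~~ (res 0 2 && res 1 3)%N ->
  ~~ (res 0 3 && res 1 2)%N ->
  exists a, amplitude_ok e res a.
Proof.
move=> /andP[e0 e1] rsym h1 h2 h3.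
have solo (j0 : nat) : (j0 < 4)%N ->
    (forall u v : 'I_4, (u < v)%N -> res u v -> (val u == j0) || (val v == j0)) ->
    amplitude_ok e res (fun j => if j == j0 then e else 1).
  move=> j04 hres.
  have prodE : \prod_(j < 4) (if j == j0 :> nat then e else 1) = e.
    by case: j0 j04 {hres} => [|[|[|[|//]]]] _; rewrite !big_ord_recl big_ord0 /=;
       rewrite !mul1r !mulr1.
  split=> [j||u v uv ruv]; rewrite ?prodE.
  - by case: ifP => _; rewrite ?e0 ?ltr01 ?lexx.
  - by rewrite exprS ler_piMr ?exprn_ile1 // ltW.
  have : (val u == j0) || (val v == j0).
    case: (ltngtP u v) => [lt|lt|eq].
    - exact: hres.
    - by rewrite orbC hres // rsym.
    - by move: uv; rewrite (val_inj eq) eqxx.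
  rewrite expr2; case: (val u == j0); case: (val v == j0) => //= _;
  rewrite ?mul1r ?mulr1 //.
  by rewrite ler_piMr ?mulr_ge0 ?mulr_ile1 ?(ltW e0).
have anti (j0 : nat) : (j0 < 4)%N ->
    (forall u v : 'I_4, (u < v)%N -> res u v -> (val u != j0) && (val v != j0)) ->
    amplitude_ok e res (fun j => if j == j0 then 1 else e).
  move=> j04 hres.
  have prodE : \prod_(j < 4) (if j == j0 :> nat then 1 else e) = e ^+ 3.
    by case: j0 j04 {hres} => [|[|[|[|//]]]] _; rewrite !big_ord_recl big_ord0 /=;
       rewrite !mul1r !mulr1 exprS expr2.
  split=> [j||u v uv ruv]; rewrite ?prodE //.
  - by case: ifP => _; rewrite ?e0 ?ltr01 ?lexx.
  have : (val u != j0) && (val v != j0).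
    case: (ltngtP u v) => [lt|lt|eq].
    - exact: hres.
    - by rewrite andbC hres // rsym.
    - by move: uv; rewrite (val_inj eq) eqxx.
  move=> /andP[/negPf-> /negPf->]; rewrite -exprS -expr2 -exprM //.
have ord4 (Q : nat -> nat -> bool) :
    [&& Q 0 1, Q 0 2, Q 0 3, Q 1 2, Q 1 3 & Q 2 3]%N ->
    forall u v : 'I_4, (u < v)%N -> Q u v.
  by move=> /and5P[q1 q2 q3 q4 /andP[q5 q6]]
    [[|[|[|[|//]]]] ?] [[|[|[|[|//]]]] ?].
have soloB (j0 : nat) : (j0 < 4)%N ->
    (let Q u v := res u v ==> ((u == j0) || (v == j0)) in
     [&& Q 0 1, Q 0 2, Q 0 3, Q 1 2, Q 1 3 & Q 2 3])%N ->
    exists a, amplitude_ok e res a.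
  move=> j04 hQ; exists (fun j => if j == j0 then e else 1); apply: solo => //.
  by move=> u v uv; apply/implyP; exact: (ord4 _ hQ).
have antiB (j0 : nat) : (j0 < 4)%N ->
    (let Q u v := res u v ==> ((u != j0) && (v != j0)) in
     [&& Q 0 1, Q 0 2, Q 0 3, Q 1 2, Q 1 3 & Q 2 3])%N ->
    exists a, amplitude_ok e res a.
  move=> j04 hQ; exists (fun j => if j == j0 then 1 else e); apply: anti => //.
  by move=> u v uv; apply/implyP; exact: (ord4 _ hQ).
move: h1 h2 h3 (soloB 0%N isT) (soloB 1%N isT) (soloB 2%N isT) (soloB 3%N isT)
  (antiB 0%N isT) (antiB 1%N isT) (antiB 2%N isT) (antiB 3%N isT) => /=.
case: (res 0 1)%N; case: (res 0 2)%N; case: (res 0 3)%N; case: (res 1 2)%N;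
case: (res 1 3)%N; case: (res 2 3)%N => //= _ _ _ s0 s1 s2 s3 a0 a1 a2 a3;
by [apply: s0|apply: s1|apply: s2|apply: s3|apply: a0|apply: a1|apply: a2|apply: a3].
Qed.

Lemma sum4 (T : nmodType) (F : 'I_4 -> T) :
  \sum_(r < 4) F r = F (inord 0) + F (inord 1) + F (inord 2) + F (inord 3).
Proof.
rewrite !big_ord_recl big_ord0 addr0 !addrA.
by congr (F _ + F _ + F _ + F _); apply: val_inj; rewrite /= ?inordK.
Qed.

Lemma forall4 (Q : 'I_4 -> Prop) :
  Q (inord 0) -> Q (inord 1) -> Q (inord 2) -> Q (inord 3) -> forall r, Q r.
Proof.
move=> q0 q1 q2 q3 r; rewrite -(inord_val r).
by case: r => [[|[|[|[|//]]]] ?].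
Qed.

(** * Phases attached to a four-point pattern *)

Section Pattern.
Variables k0 k1 k2 k3 : int.
Hypotheses (k01 : k0 < k1) (k12 : k1 < k2) (k23 : k2 < k3).
Hypothesis nonparallel : k0 + k3 != k1 + k2.

Definition pattern_pt (r : nat) : int := nth 0 [:: k0; k1; k2; k3] r.
Definition minor (j : nat) : int :=
  (-1) ^+ j.+1 * gap_minor (k1 - k0) (k2 - k1) (k3 - k2) j.
(** This affine relation between the points and the next one span all of them, so a vector
    orthogonal to both is an affine function of the points. *)
Definition rel012 (j : nat) : int := nth 0 [:: k1 - k2; k2 - k0; k0 - k1; 0] j.
Definition rel013 (j : nat) : int := nth 0 [:: k1 - k3; k3 - k0; 0; k0 - k1] j.
(** A polynomial has three parameters, indexed by [t]: a leading coefficient and two linear ones.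
    The exponent of a character of colour [j] at [y] is linear in these parameters, with
    coefficients [phase t j y]. *)
Definition phase (t j : nat) (y : int) : int :=
  nth 0 [:: minor j * y ^+ 2; rel012 j * y; rel013 j * y] t.
Definition colour_resonance : rel nat :=
  resonant (k1 - k0) (k2 - k1) (k3 - k2).

Lemma phase_pattern (t : 'I_3) (y d : int) :
  \sum_(j < 4) phase t j (y + d * pattern_pt j) = 0.
Proof.
by case: t => [[|[|[|//]]] ?]; rewrite sum4 !inordK //= /phase /minor /rel012
  /rel013 /gap_minor /pattern_pt /=; ring.
Qed.

Lemma pt_neq (r s : 'I_4) : r != s -> pattern_pt r != pattern_pt s.
Proof.
move: k01 k12 k23; case: r => [[|[|[|[|//]]]] ?];
by case: s => [[|[|[|[|//]]]] ?]; rewrite /pattern_pt /=; lia.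
Qed.

Lemma abs_minor (j : 'I_4) :
  `|minor j| = gap_minor (k1 - k0) (k2 - k1) (k3 - k2) j /\ minor j != 0.
Proof.
have pos : 0 < gap_minor (k1 - k0) (k2 - k1) (k3 - k2) j.
  by case: j => [[|[|[|[|//]]]] ?]; rewrite /gap_minor /= !mulr_gt0 //;
    move: k01 k12 k23; lia.
split; first by rewrite /minor normrM normrX normrN1 expr1n mul1r gtr0_norm.
by rewrite -normr_gt0 /minor normrM normrX normrN1 expr1n mul1r gtr0_norm.
Qed.

Lemma dist_gap_pairs (a b c d : 'I_4) : uniq [:: a; b; c; d] ->
  (`|pattern_pt a - pattern_pt c|, `|pattern_pt b - pattern_pt d|)
    \in gap_pairs (k1 - k0) (k2 - k1) (k3 - k2).
Proof.
have dist (p q : int) : p < q -> (`|p - q| = q - p) * (`|q - p| = q - p).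
  by move=> pq; split; lia.
have k02 := lt_trans k01 k12; have k13 := lt_trans k12 k23.
have k03 := lt_trans k02 k23.
have dE := (dist _ _ k01, dist _ _ k02, dist _ _ k03, dist _ _ k12,
            dist _ _ k13, dist _ _ k23).
have -> : gap_pairs (k1 - k0) (k2 - k1) (k3 - k2) =
    [:: (k1 - k0, k3 - k2); (k3 - k2, k1 - k0); (k2 - k0, k3 - k1);
        (k3 - k1, k2 - k0); (k3 - k0, k2 - k1); (k2 - k1, k3 - k0)].
  by rewrite /gap_pairs; do ![congr (_ :: _)]; congr (_, _); ring.
case: a => [[|[|[|[|//]]]] ?]; case: b => [[|[|[|[|//]]]] ?] //;
case: c => [[|[|[|[|//]]]] ?] //; case: d => [[|[|[|[|//]]]] ?] // _;
by rewrite /pattern_pt /= !dE !inE !xpair_eqE !eqxx ?orbT.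
Qed.

Lemma colour_resonance_relation (a b c d u v : 'I_4) : uniq [:: a; b; c; d] ->
  minor u * (pattern_pt a - pattern_pt c) + minor v * (pattern_pt b - pattern_pt d) = 0 ->
  colour_resonance u v.
Proof.
move=> abcd /eqP; rewrite addr_eq0 => /eqP e; apply/hasP.
exists (`|pattern_pt a - pattern_pt c|, `|pattern_pt b - pattern_pt d|); first exact: dist_gap_pairs.
have [<- _] := abs_minor u; have [<- _] := abs_minor v.
by rewrite /= -!normrM e normrN.
Qed.

Lemma distinct_not_parallel (a b c d : 'I_4) : uniq [:: a; b; c; d] ->
  pattern_pt a + pattern_pt b != pattern_pt c + pattern_pt d.
Proof.
move: k01 k12 k23 nonparallel.
by case: a => [[|[|[|[|//]]]] ?]; case: b => [[|[|[|[|//]]]] ?] //;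
case: c => [[|[|[|[|//]]]] ?] //; case: d => [[|[|[|[|//]]]] ?] //;
rewrite /pattern_pt /=; lia.
Qed.

(** The two equations make [q] an affine function of the points. If it is not constant, it is
    strictly monotone; four distinct integers whose absolute values sum to at most 4 are
    consecutive, so the points would form an arithmetic progression, against [nonparallel]. *)
Lemma small_affine (q0 q1 q2 q3 : int) :
  `|q0| + `|q1| + `|q2| + `|q3| <= 4 ->
  q0 * rel012 0 + q1 * rel012 1 + q2 * rel012 2 + q3 * rel012 3 = 0 ->
  q0 * rel013 0 + q1 * rel013 1 + q2 * rel013 2 + q3 * rel013 3 = 0 ->
  exists2 s : int, s \in [:: 0; 1; -1] & [/\ q0 = s, q1 = s, q2 = s & q3 = s].
Proof.
rewrite /rel012 /rel013 /= => small h2 h3.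
have [] := (k01, k12, k23, nonparallel) => -[[g01 g12] g23] np.
have e2 : (q2 - q0) * (k1 - k0) = (q1 - q0) * (k2 - k0) by lia.
have e3 : (q3 - q0) * (k1 - k0) = (q1 - q0) * (k3 - k0) by lia.
have mono (p1 p2 p3 a b c : int) : 0 < a -> a < b -> b < c -> 0 < p1 ->
    p2 * a = p1 * b -> p3 * a = p1 * c -> p1 < p2 /\ p2 < p3.
  by move=> *; split; nia.
have ap (p1 p2 p3 : int) : p1 = 1 -> p2 = 2 -> p3 = 3 ->
    p2 * (k1 - k0) = p1 * (k2 - k0) -> p3 * (k1 - k0) = p1 * (k3 - k0) -> False.
  by move=> -> -> ->; lia.
have q10 : q1 = q0.
  case: (ltgtP q1 q0) => // h; exfalso.
  - have [] := @mono (q0 - q1) (q0 - q2) (q0 - q3) (k1 - k0) (k2 - k0) (k3 - k0);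
      try by lia.
    move=> h12 h13; apply: (ap (q0 - q1) (q0 - q2) (q0 - q3)); by lia.
  - have [] := @mono (q1 - q0) (q2 - q0) (q3 - q0) (k1 - k0) (k2 - k0) (k3 - k0);
      try by lia.
    move=> h12 h13; apply: (ap (q1 - q0) (q2 - q0) (q3 - q0)); by lia.
have q20 : q2 = q0 by nia.
have q30 : q3 = q0 by nia.
by exists q0 => //; rewrite !inE; lia.
Qed.

End Pattern.

(** * Which products of quadratic phases survive averaging *)

Lemma perm_big_ord4 (T : Type) (idx : T) (op : Monoid.com_law idx)
    (F : 'I_4 -> T) (s : seq 'I_4) : perm_eq (enum 'I_4) s ->
  \big[op/idx]_(i < 4) F i = \big[op/idx]_(i <- s) F i.
Proof. by move=> es; rewrite -big_enum; exact: perm_big. Qed.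

Lemma complement_pair (r s : 'I_4) : r != s ->
  exists p q, uniq [:: r; s; p; q] /\ perm_eq (enum 'I_4) [:: r; s; p; q].
Proof.
move=> rs; have : #|~: [set r; s]| = 2%N.
  by apply/eqP; rewrite -(eqn_add2l #|[set r; s]|) cardsC card_ord cards2 rs.
case/eqP/cards2P => p [q [pq e]].
have rspq : uniq [:: r; s; p; q].
  have pin : p \notin [set r; s] by rewrite -in_setC e !inE eqxx.
  have qin : q \notin [set r; s] by rewrite -in_setC e !inE eqxx orbT.
  move: pin qin; rewrite /= !inE !negb_or (negPf rs) => /andP[pr ps] /andP[qr qs].
  by rewrite !(eq_sym r p) (eq_sym r q) (eq_sym s p) (eq_sym s q) pr ps qr qs pq.
exists p, q; split=> //; apply: uniq_perm => //; first exact: enum_uniq.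
have sub : {subset [:: r; s; p; q] <= enum 'I_4} by move=> i; rewrite mem_enum.
by have [|_ h] := uniq_min_size rspq sub; [rewrite size_enum_ord | move=> i; rewrite h].
Qed.

Section Edges.
Variables k0 k1 k2 k3 : int.
Hypotheses (k01 : k0 < k1) (k12 : k1 < k2) (k23 : k2 < k3).
Hypothesis nonparallel : k0 + k3 != k1 + k2.
Local Notation pt := (pattern_pt k0 k1 k2 k3).
Local Notation minor := (minor k0 k1 k2 k3).
Local Notation rel012 := (rel012 k0 k1 k2).
Local Notation rel013 := (rel013 k0 k1 k3).
Local Notation phase := (phase k0 k1 k2 k3).
Local Notation colour_resonance := (colour_resonance k0 k1 k2 k3).
Variables (V : finType) (d : int) (o : 'I_4 -> option (V * V * 'I_4)).

(** The [r]-th factor of a product of four characters is encoded as a coloured edge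
    [Some (a, b, j)], standing for the difference of the polynomials [a] and [b] taken with the
    phases of colour [j]; [None] is the constant factor 1. *)
Definition inc (e : option (V * V * 'I_4)) (v : V) : int :=
  if e is Some (a, b, _) then (a == v)%:R - (b == v)%:R else 0.
Definition colour (e : option (V * V * 'I_4)) : 'I_4 :=
  if e is Some (_, _, j) then j else ord0.
Definition loopless (e : option (V * V * 'I_4)) : bool :=
  if e is Some (a, b, _) then a != b else true.
Definition coef (t : 'I_3) (v : V) (x : int) : int :=
  \sum_(r < 4) inc (o r) v * phase t (colour (o r)) (x + d * pt r).
Definition slope (t : 'I_3) (v : V) : int :=
  nth 0 [:: 2 * d * (\sum_(r < 4) inc (o r) v * (minor (colour (o r)) * pt r));
            \sum_(r < 4) inc (o r) v * rel012 (colour (o r));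
            \sum_(r < 4) inc (o r) v * rel013 (colour (o r))] t.

(** Only the parameter 0 brings terms in [x ^+ 2], and they cancel when the minors balance at
    [v]. *)
Lemma coef_slope (t : 'I_3) (v : V) (x x' : int) :
  val t != 0%N \/ \sum_(r < 4) inc (o r) v * minor (colour (o r)) = 0 ->
  coef t v x - coef t v x' = slope t v * (x - x').
Proof.
rewrite /coef /slope -sumrB; case: t => [[|[|[|//]]] lt_t] /=.
- case=> // bal; transitivity (\sum_(r < 4)
    (2 * d * (inc (o r) v * (minor (colour (o r)) * pt r)) * (x - x') +
     inc (o r) v * minor (colour (o r)) * (x ^+ 2 - x' ^+ 2))).
    by apply: eq_bigr => r _; rewrite /phase /=; ring.
  by rewrite big_split /= -!mulr_suml -mulr_sumr bal mul0r addr0.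
- by rewrite mulr_suml => _; apply: eq_bigr => r _; rewrite /phase /=; ring.
- by rewrite mulr_suml => _; apply: eq_bigr => r _; rewrite /phase /=; ring.
Qed.

(* The coefficient of the parameter [(v, t)] is then a nonconstant affine
   function of the translation [x]. *)
Definition moving (t : 'I_3) (v : V) : bool :=
  (slope t v != 0) && ((val t != 0%N) ||
    (\sum_(r < 4) inc (o r) v * minor (colour (o r)) == 0)).

Lemma moving_coef (t : 'I_3) (v : V) (x x' : int) : moving t v ->
  coef t v x - coef t v x' = slope t v * (x - x').
Proof.
case/andP => _ h; apply: coef_slope.
by case/orP: h => [|/eqP]; [left|right].
Qed.

Definition charge (v : V) (j : 'I_4) : int :=
  \sum_(r < 4) inc (o r) v * (colour (o r) == j)%:R.

Lemma sum_charge (v : V) (F : nat -> int) :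
  \sum_(r < 4) inc (o r) v * F (colour (o r)) =
  \sum_(j < 4) charge v j * F j.
Proof.
under [RHS]eq_bigr => j _ do rewrite mulr_suml.
rewrite exchange_big /=; apply: eq_bigr => r _.
rewrite (bigD1 (colour (o r))) //= eqxx mulr1 big1 ?addr0 // => j jr.
by rewrite eq_sym (negPf jr) mulr0 mul0r.
Qed.

Hypothesis o_loopless : forall r, loopless (o r).

Lemma incP (r : 'I_4) (v : V) :
  [\/ inc (o r) v = 0,
      inc (o r) v = 1 /\ exists b, o r = Some (v, b, colour (o r)) |
      inc (o r) v = -1 /\ exists a, o r = Some (a, v, colour (o r))].
Proof.
have := o_loopless r; case: (o r) => [[[a b] j]|] //= ab; last by constructor 1.
case: (eqVneq a v) => [av|av]; case: (eqVneq b v) => [bv|bv].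
- by rewrite av bv eqxx in ab.
- by constructor 2; split=> //; exists b; rewrite av.
- by constructor 3; split=> //; exists a; rewrite bv.
- by constructor 1.
Qed.

Lemma inc_le1 (r : 'I_4) (v : V) : `|inc (o r) v| <= 1.
Proof. by case: (incP r v) => [->|[-> _]|[-> _]]. Qed.

Lemma charge_norm (v : V) : \sum_(j < 4) `|charge v j| <= 4.
Proof.
apply: (@le_trans _ _ (\sum_(j < 4) \sum_(r < 4)
    `|inc (o r) v * (colour (o r) == j)%:R|)).
  by apply: ler_sum => j _; exact: ler_norm_sum.
rewrite exchange_big /= -[leRHS](_ : \sum_(r < 4) 1 = 4) //; last first.
  by rewrite sumr_const card_ord.
apply: ler_sum => r _.
rewrite (bigD1 (colour (o r))) //= eqxx mulr1 big1 ?addr0 ?inc_le1 // => j jr.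
by rewrite eq_sym (negPf jr) mulr0 normr0.
Qed.

(** The two vanishing slopes are the equations of [small_affine], and four edges bound the total
    charge at [v] by 4. *)
Lemma charge_constant (v : V) :
  slope (inord 1) v = 0 -> slope (inord 2) v = 0 ->
  exists2 s : int, s \in [:: 0; 1; -1] & forall j, charge v j = s.
Proof.
rewrite /slope !inordK //= !sum_charge !sum4 !inordK // => h2 h3.
have := charge_norm v; rewrite sum4 => hn.
have [s s01 [q0 q1 q2 q3]] := small_affine k01 k12 k23 nonparallel hn h2 h3.
by exists s => //; apply: forall4.
Qed.

Lemma minor_balanced (v : V) (s : int) : (forall j, charge v j = s) ->
  \sum_(r < 4) inc (o r) v * minor (colour (o r)) = 0.
Proof.
move=> hs; rewrite sum_charge; under eq_bigr => j _ do rewrite hs.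
by rewrite -mulr_sumr sum4 !inordK // /minor /gap_minor /=; ring.
Qed.

Lemma sum_inc (v : V) (s : int) : (forall j, charge v j = s) ->
  \sum_(r < 4) inc (o r) v = 4 * s.
Proof.
move=> hs; have := sum_charge v (fun=> 1).
under eq_bigr => r _ do rewrite mulr1; move=> ->.
under eq_bigr => r _ do rewrite mulr1 hs.
by rewrite sumr_const card_ord mulr_natl.
Qed.

Lemma all_inc (v : V) (s : int) : s * s = 1 -> (forall j, charge v j = s) ->
  forall r, inc (o r) v = s.
Proof.
move=> ss hs; have := sum_inc hs; rewrite sum4.
have := inc_le1 (inord 0) v; have := inc_le1 (inord 1) v.
have := inc_le1 (inord 2) v; have := inc_le1 (inord 3) v.
have : s = 1 \/ s = -1 by nia.
by case=> -> h3 h2 h1 h0 tot; apply: forall4; lia.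
Qed.

(** Edges at [v] cancel in pairs of one colour and opposite direction. A single pair [r], [s] would
    give [minor u * (pt r - pt s) = 0], so there are two pairs, of colours [u] and [w]. Equal
    colours contradict [distinct_not_parallel]; different ones are in resonance. *)
Lemma zero_charge (R : comPzRingType) (A : nat -> R) (v : V) :
  (forall j, charge v j = 0) ->
  \sum_(r < 4) inc (o r) v * (minor (colour (o r)) * pt r) = 0 ->
  (forall r, inc (o r) v = 0) \/
  (forall r, inc (o r) v != 0) /\
  exists u w : 'I_4, [/\ u != w, colour_resonance u w &
    \prod_(r < 4) A (colour (o r)) = (A u * A w) ^+ 2].
Proof.
move=> hq rel; case: (boolP [forall r, inc (o r) v == 0]) => [/forallP h|].
  by left=> r; apply/eqP.
rewrite negb_forall => /existsP[r Dr]; right.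
set D := fun r => inc (o r) v; set u := colour (o r).
have Dval s : [\/ D s = 0, D s = 1 | D s = -1].
  by case: (incP s v) => [?|[? _]|[? _]]; [constructor 1|constructor 2|constructor 3].
(* If no edge cancelled [r], all the terms in the charge of colour [u] would have the sign of [D r],
   and their sum would not vanish. *)
have [s us Ds] : exists2 s, colour (o s) = u & D s = - D r.
  have [/existsP[s /andP[/eqP us /eqP Ds]]|nex] :=
      boolP [exists s, (colour (o s) == u) && (D s == - D r)]; first by exists s.
  have nonneg i : true -> 0 <= D r * (D i * (colour (o i) == u)%:R).
    move=> _; move/existsPn: nex => /(_ i); case: (colour (o i) == u); last by rewrite !mulr0.
    rewrite mulr1 /=; move: Dr; rewrite -/(D r).
    by case: (Dval r) => ->; case: (Dval i) => ->.
  have : \sum_i D r * (D i * (colour (o i) == u)%:R) = 0.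
    by rewrite -mulr_sumr [X in _ * X]hq mulr0.
  move/(psumr_eq0P nonneg)/(_ r isT)/eqP.
  by rewrite eqxx mulr1 mulf_eq0 orbb (negPf Dr).
have rs : r != s.
  by apply: contra_neq Dr => e; move: Ds; rewrite -e -/(D r); lia.
have [p [q [rspq perm4]]] := complement_pair rs.
have sumE (F : 'I_4 -> int) : \sum_(i < 4) F i = F r + F s + F p + F q.
  by rewrite (perm_big_ord4 _ _ perm4) !big_cons big_nil /= addr0 !addrA.
have bal j : D p * (colour (o p) == j)%:R + D q * (colour (o q) == j)%:R = 0.
  have : \sum_(i < 4) D i * (colour (o i) == j)%:R = 0 := hq j.
  by rewrite sumE us Ds -/u mulNr subrr add0r.
have {}rel : \sum_(i < 4) D i * (minor (colour (o i)) * pt i) = 0 := rel.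
rewrite sumE us Ds -/u in rel.
have [_ nzu] := abs_minor k01 k12 k23 nonparallel u.
have Dp : D p != 0.
  apply/eqP => Dp0; have := bal (colour (o q)).
  rewrite Dp0 mul0r add0r eqxx mulr1 => Dq0.
  move: rel; rewrite Dp0 Dq0 !mul0r !addr0 mulNr -mulrBr -mulrBr => /eqP.
  rewrite mulf_eq0 (negPf Dr) /= mulf_eq0 (negPf nzu) /= subr_eq0.
  by rewrite (negPf (pt_neq k01 k12 k23 nonparallel rs)).
have qp : colour (o q) = colour (o p).
  apply/eqP; have := bal (colour (o p)); rewrite eqxx mulr1.
  by case: eqP => // _; rewrite mulr0 addr0 => /eqP; rewrite (negPf Dp).
have Dq : D q = - D p.
  by apply/eqP; have := bal (colour (o p)); rewrite qp eqxx !mulr1 -addr_eq0 addrC => ->.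
split.
  move=> i; have : i \in [:: r; s; p; q] by rewrite -(perm_mem perm4) mem_enum.
  by rewrite !inE => /or4P[] /eqP-> //; rewrite -/(D _) ?Ds ?Dq oppr_eq0.
set w := colour (o p) in qp *.
have srel : D r * (minor u * (pt r - pt s)) + D p * (minor w * (pt p - pt q)) = 0.
  by rewrite -[RHS]rel qp Dq -/w; ring.
have rspq' : uniq [:: r; p; s; q] /\ uniq [:: r; q; s; p].
  by move: rspq; rewrite /= !inE !negb_or => /and4P[/and3P[-> -> ->]
     /andP[sp sq] pq _]; rewrite !(eq_sym p s) !(eq_sym q s) (eq_sym q p) sp sq pq.
have Dpr : D p = D r \/ D p = - D r.
  move: Dr Dp; rewrite -/(D r).
  by case: (Dval r) => ->; case: (Dval p) => -> // _ _; [left|right|right|left].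
exists u, w; split.
- apply/eqP => uw; have [h1 h2] := rspq'; move: srel; rewrite -uw.
  have par := distinct_not_parallel k01 k12 k23 nonparallel.
  have [->|->] := Dpr => /eqP; rewrite ?mulNr -?mulrDr -?mulrBr.
    rewrite mulf_eq0 (negPf Dr) /= mulf_eq0 (negPf nzu) /= addrACA -opprD subr_eq0.
    by rewrite (negPf (par _ _ _ _ h1)).
  rewrite mulf_eq0 (negPf Dr) /= mulf_eq0 (negPf nzu) /= opprB addrACA -opprD subr_eq0.
  by rewrite (negPf (par _ _ _ _ h2)).
- have [h1 h2] := rspq'; move: srel.
  have res := colour_resonance_relation k01 k12 k23 nonparallel.
  have [->|->] := Dpr => /eqP; rewrite ?mulNr -?mulrDr -?mulrBr.
    by rewrite mulf_eq0 (negPf Dr) => /eqP; exact: res.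
  rewrite mulf_eq0 (negPf Dr) -mulrN opprB => /eqP; exact: res.
- rewrite (perm_big_ord4 _ _ perm4) !big_cons big_nil /= mulr1 us qp -/u -/w; ring.
Qed.
Lemma inc_eq1 (r : 'I_4) (v : V) : inc (o r) v = 1 ->
  exists b, o r = Some (v, b, colour (o r)).
Proof. by case: (incP r v) => [->|[_]|[-> _]]. Qed.

Lemma inc_eqN1 (r : 'I_4) (v : V) : inc (o r) v = -1 ->
  exists a, o r = Some (a, v, colour (o r)).
Proof. by case: (incP r v) => [->|[-> _]|[_]]. Qed.

(** Every colour has nonzero charge, so each of the four occurs, and only four edges are
    available. *)
Lemma charge_single (v : V) (s : int) : s * s = 1 ->
  (forall j, charge v j = s) -> injective (fun r => colour (o r)).
Proof.
move=> ss hs; have hr := all_inc ss hs.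
have onto : forall j, j \in codom (fun r => colour (o r)).
  move=> j; apply: contraPT (hs j) => /codomP nj.
  rewrite /charge big1 => [z|r _]; first by move: ss; rewrite -z.
  by case: eqP => [e|_]; [case: nj; exists r | rewrite mulr0].
apply/injectiveP/card_uniqP; rewrite size_map -cardE.
by apply: eq_card => j; rewrite onto.
Qed.

(** If nothing moves, the charge at each vertex is the same for all colours. A vertex of charge 1 or
    -1 is the same end of all four edges, which carry each colour once; the other end of one edge
    then has the opposite charge and is the other end of all. If all charges vanish, both ends of
    one edge lie on every edge by [zero_charge], so all edges join the same two vertices. *)
Lemma edges_trichotomy (R : comPzRingType) (A : nat -> R) : d != 0 ->
  (exists r, o r != None) ->
  [\/ exists t v, moving t v,
      exists (a b : V) (tau : {perm 'I_4}),
        forall r, o r = Some (a, b, tau r) |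
      exists a b : V, (forall r, o r = Some (a, b, colour (o r)) \/
                                 o r = Some (b, a, colour (o r))) /\
        exists u w : 'I_4, [/\ u != w, colour_resonance u w &
          \prod_(r < 4) A (colour (o r)) = (A u * A w) ^+ 2]].
Proof.
move=> d0 [r0 or0].
case: (boolP [exists v, slope (inord 1) v != 0]) => [/existsP[v hv]|/existsPn h1].
  by constructor 1; exists (inord 1), v; rewrite /moving hv /= inordK.
case: (boolP [exists v, slope (inord 2) v != 0]) => [/existsP[v hv]|/existsPn h2].
  by constructor 1; exists (inord 2), v; rewrite /moving hv /= inordK.
have hs v : exists2 s : int, s \in [:: 0; 1; -1] & forall j, charge v j = s.
  by apply: charge_constant; apply/eqP; [have := h1 v | have := h2 v];
    rewrite negbK.
case: (boolP [exists v, slope (inord 0) v != 0]) => [/existsP[v hv]|/existsPn h0].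
  constructor 1; exists (inord 0), v; rewrite /moving hv /=.
  by have [s _ hsv] := hs v; rewrite (minor_balanced hsv) eqxx orbT.
have hm v : \sum_(r < 4) inc (o r) v * (minor (colour (o r)) * pt r) = 0.
  apply/eqP; have := h0 v; rewrite negbK /slope inordK //= !mulf_eq0.
  by rewrite (negPf d0).
case: (boolP [exists v, charge v ord0 != 0]) => [/existsP[v hv]|/existsPn hq0].
  constructor 2; have [s] := hs v; rewrite !inE.
  case/or3P => /eqP s1 hsv; first by rewrite hsv s1 in hv.
  - have ss : s * s = 1 by rewrite s1.
    have tail r := inc_eq1 (etrans (all_inc ss hsv r) s1).
    have [b ob] := tail r0.
    have vb : b != v by have := o_loopless r0; rewrite ob /= eq_sym.
    have [s' s01 hsb] := hs b.
    have inc_le0 r : inc (o r) b <= 0.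
      by have [c ->] := tail r; rewrite /= eq_sym (negPf vb) sub0r oppr_le0.
    have incr0 : inc (o r0) b = -1 by rewrite ob /= eq_sym (negPf vb) eqxx.
    have := sum_inc hsb; rewrite (bigD1 r0) //= incr0.
    have le0 : \sum_(i < 4 | i != r0) inc (o i) b <= 0.
      by apply: sumr_le0 => i _; exact: inc_le0.
    move=> e; have s'1 : s' = -1.
      by move: s01; rewrite !inE => /or3P[] /eqP s'E //; move: e le0; rewrite s'E; set S := \sum_(_ < _ | _) _; lia.
    have ss' : s' * s' = 1 by rewrite s'1.
    exists v, b, (perm (charge_single ss hsv)) => r; rewrite permE.
    have [c oc] := tail r; have [a oa] := inc_eqN1 (etrans (all_inc ss' hsb r) s'1).
    by rewrite oc in oa *; case: oa => _ ->.
  - have ss : s * s = 1 by rewrite s1.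
    have head r := inc_eqN1 (etrans (all_inc ss hsv r) s1).
    have [a oa] := head r0.
    have va : a != v by have := o_loopless r0; rewrite oa.
    have [s' s01 hsa] := hs a.
    have inc_ge0 r : 0 <= inc (o r) a.
      by have [c ->] := head r; rewrite /= (eq_sym v) (negPf va) subr0.
    have incr0 : inc (o r0) a = 1 by rewrite oa /= eqxx (eq_sym v) (negPf va).
    have := sum_inc hsa; rewrite (bigD1 r0) //= incr0.
    have ge0 : 0 <= \sum_(i < 4 | i != r0) inc (o i) a.
      by apply: sumr_ge0 => i _; exact: inc_ge0.
    move=> e; have s'1 : s' = 1.
      by move: s01; rewrite !inE => /or3P[] /eqP s'E //; move: e ge0; rewrite s'E; set S := \sum_(_ < _ | _) _; lia.
    have ss' : s' * s' = 1 by rewrite s'1.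
    exists a, v, (perm (charge_single ss hsv)) => r; rewrite permE.
    have [c oc] := head r; have [b ob] := inc_eq1 (etrans (all_inc ss' hsa r) s'1).
    by rewrite oc in ob *; case: ob => ->.
have hq v j : charge v j = 0.
  by have [s _ hsv] := hs v; have := hq0 v; rewrite negbK !hsv => /eqP.
constructor 3; case er0: (o r0) or0 => [[[a b] j]|] // _.
have ab : a != b by have := o_loopless r0; rewrite er0.
have all_nz v : inc (o r0) v != 0 -> (forall r, inc (o r) v != 0) /\
    exists u w : 'I_4, [/\ u != w, colour_resonance u w &
      \prod_(r < 4) A (colour (o r)) = (A u * A w) ^+ 2].
  by move=> nz; have [/(_ r0) z|//] := zero_charge A (hq v) (hm v); rewrite z in nz.
have inca : inc (o r0) a != 0 by rewrite er0 /= eqxx (eq_sym b) (negPf ab).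
have incb : inc (o r0) b != 0 by rewrite er0 /= eqxx (negPf ab).
have [nza res] := all_nz a inca; have [nzb _] := all_nz b incb.
exists a, b; split=> // r; have := nza r; have := nzb r; have := o_loopless r.
case: (o r) => [[[a' b'] j']|] //= ab'.
case: (eqVneq a' b) => [->|a'b]; case: (eqVneq b' b) => [->|b'b] //.
- by case: (eqVneq b' a) => [->|b'a] _; [right|rewrite (eq_sym b a) (negPf ab)].
- by case: (eqVneq a' a) => [->|a'a] _; [left|rewrite (eq_sym b a) (negPf ab)].
Qed.

End Edges.

(** * Moments of random exponential sums *)

Lemma closed_prim_root_exists (C : numClosedFieldType) (M : nat) :
  (0 < M)%N -> exists z : C, M.-primitive_root z.
Proof.
move=> M0; pose p : {poly C} := 'X^M - 1.
have [rs pE] := closed_field_poly_normal p.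
have p_monic : p \is monic by rewrite monicXnsubC.
rewrite (monicP p_monic) scale1r in pE.
have size_rs : size rs = M.
  by have := size_prod_XsubC rs id; rewrite -pE size_XnsubC // => -[].
have rs_unity : all M.-unity_root rs.
  by apply/allP => x xrs; rewrite /root_of_unity -/p pE root_prod_XsubC.
have uniq_rs : uniq rs.
  rewrite -separable_prod_XsubC -pE separable_Xn_sub_1 //.
  by rewrite pnatr_eq0 -lt0n.
have := has_prim_root M0 rs_unity uniq_rs.
by rewrite size_rs leqnn => /(_ isT)/hasP[z _ hz]; exists z.
Qed.

Lemma exists_le_average (R : realFieldType) (T : finType) (F : T -> R) (B : R) :
  (0 < #|T|)%N -> \sum_t F t <= #|T|%:R * B -> exists t, F t <= B.
Proof.
move=> T0 le_sum; apply/existsP; apply: contraTT le_sum => /existsPn lt_B.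
rewrite -ltNge mulr_natl -sumr_const.
have /card_gt0P[t0 _] := T0.
by apply: ltr_sum => [|t _]; [apply/hasP; exists t0; rewrite ?mem_index_enum | rewrite ltNge].
Qed.

Section RandomPhases.
Variables (C : numClosedFieldType) (M : nat) (z : C) (J : finType).
Hypothesis z_prim : M.-primitive_root z.
Local Notation Omega := {ffun J -> 'I_M}.

(** The parameters are uniform and independent modulo [M], and [z] plays the role of
    [exp (2 i pi / M)]. *)
Definition dot (w : Omega) (a : J -> int) : int := \sum_k (w k)%:Z * a k.
Definition rphase (w : Omega) (a : J -> int) : C := z ^ dot w a.

Lemma prim_root_neq0 : z != 0.
Proof.
apply/eqP => z0; have := prim_expr_order z_prim; rewrite z0 => /eqP.
by rewrite expr0n; have := prim_order_gt0 z_prim; case: M => //= m _; rewrite eq_sym oner_eq0.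
Qed.

Lemma prim_root_norm : `|z| = 1.
Proof.
apply/eqP; rewrite -(@pexpr_eq1 _ `|z| M) ?prim_order_gt0 //.
  by rewrite -normrX (prim_expr_order z_prim) normr1.
exact: prim_order_gt0 z_prim.
Qed.

Lemma exprz_norm1 (n : int) : `|z ^ n| = 1.
Proof. by case: n => n; rewrite ?NegzE -?exprnP -?exprnN ?normfV normrX prim_root_norm expr1n ?invr1. Qed.

Lemma exprz_conj (n : int) : (z ^ n)^* = z ^ (- n).
Proof.
by rewrite -invr_expz invC_norm exprz_norm1 expr1n invr1 mul1r.
Qed.

Lemma rphaseD (w : Omega) (a b : J -> int) :
  rphase w (fun k => a k + b k) = rphase w a * rphase w b.
Proof.
rewrite /rphase -expfzDr ?prim_root_neq0 // /dot -big_split /=.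
by congr (_ ^ _); apply: eq_bigr => k _; rewrite mulrDr.
Qed.

Lemma rphase_norm (w : Omega) (a : J -> int) : `|rphase w a| = 1.
Proof. exact: exprz_norm1. Qed.

Lemma rphaseN (w : Omega) (a : J -> int) :
  rphase w (fun k => - a k) = (rphase w a)^*.
Proof.
rewrite /rphase exprz_conj /dot; congr (_ ^ _).
by rewrite -sumrN; apply: eq_bigr => k _; rewrite mulrN.
Qed.

(** The sum factors over the parameters, and the factor of [k0] is a complete geometric sum with
    ratio different from 1. *)
Lemma sum_rphase (a : J -> int) (k0 : J) :
  ~~ (M%:Z %| a k0)%Z -> \sum_(w : Omega) rphase w a = 0.
Proof.
move=> ndvd.
have -> : \sum_(w : Omega) rphase w a = \prod_k \sum_(t < M) z ^ (t%:Z * a k).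
  rewrite bigA_distr_bigA /=; apply: eq_bigr => w _; rewrite /rphase /dot.
  by rewrite (big_morph (fun n => z ^ n) (id1 := 1) (op1 := *%R)) // => x y;
     rewrite expfzDr ?prim_root_neq0.
rewrite (bigD1 k0) //= [X in X * _](_ : _ = 0) ?mul0r //.
have y1 : z ^ a k0 != 1.
  apply: contraNneq ndvd => y1; rewrite dvdzE /= (prim_order_dvd z_prim).
  by case: (a k0) y1 => n; rewrite ?NegzE -?exprnP ?abszN -?exprnN // => /eqP //; rewrite invr_eq1.
have y0 : z ^ a k0 - 1 != 0 by rewrite subr_eq0.
apply: (mulfI y0); rewrite mulr0.
transitivity ((z ^ a k0) ^+ M - 1).
  rewrite subrX1; congr (_ * _); apply: eq_bigr => t _.
  by rewrite mulrC -exprz_exp -exprnP.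
rewrite exprnP exprz_exp mulrC -exprz_exp -exprnP (prim_expr_order z_prim).
by rewrite exp1rz subrr.
Qed.

Lemma rphase0 (w : Omega) (a : J -> int) : (forall k, a k = 0) -> rphase w a = 1.
Proof. by move=> a0; rewrite /rphase /dot big1 ?expr0z // => k _; rewrite a0 mulr0. Qed.

Variable N : nat.
Definition csum (w : Omega) (X : {set 'I_N}) (c : J -> int -> int) : C :=
  \sum_(x in X) rphase w (fun k => c k (val x)%:Z).

(** The bound on the slope keeps differences of values on the interval below [M], so that they are
    nonzero modulo [M] when the points differ. *)
Definition affine_at (c : J -> int -> int) (k0 : J) : Prop :=
  exists2 s : int, (s != 0) && (`|s| * N%:Z < M%:Z) &
    forall x x', c k0 x - c k0 x' = s * (x - x').

Lemma affine_not_dvd (c : J -> int -> int) (k0 : J) (x x' : 'I_N) :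
  affine_at c k0 -> x != x' -> ~~ (M%:Z %| c k0 (val x)%:Z - c k0 (val x')%:Z)%Z.
Proof.
move=> [s /andP[s0 sN] ->] xx'; apply/negP => dvd.
have nz : s * (x%:Z - x'%:Z) != 0.
  by rewrite mulf_neq0 // subr_eq0 eqz_nat.
move: dvd; rewrite dvdzE => /dvdn_leq; rewrite absz_gt0 => /(_ nz).
apply/negP; rewrite -ltnNge -ltz_nat abszE normrM /=.
apply: le_lt_trans sN; apply: ler_pM => //.
by have := ltn_ord x; have := ltn_ord x'; lia.
Qed.

Lemma csum_norm2 (w : Omega) (X : {set 'I_N}) (c : J -> int -> int) :
  `|csum w X c| ^+ 2 = \sum_(x in X) \sum_(x' in X)
    rphase w (fun k => c k (val x)%:Z - c k (val x')%:Z).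
Proof.
rewrite normCK /csum rmorph_sum /= mulr_suml; apply: eq_bigr => x _.
rewrite mulr_sumr; apply: eq_bigr => x' _.
by rewrite -rphaseN -rphaseD.
Qed.

Lemma csum_second_moment (X : {set 'I_N}) (c : J -> int -> int) (k0 : J) :
  affine_at c k0 ->
  \sum_(w : Omega) `|csum w X c| ^+ 2 = #|X|%:R * #|{: Omega}|%:R.
Proof.
move=> aff; under eq_bigr => w _ do rewrite csum_norm2.
rewrite exchange_big /= -sumr_const mulr_suml; apply: eq_bigr => x xX.
rewrite exchange_big /= (bigD1 x) //= [X in _ + X]big1 => [|x' /andP[_ xx']].
  rewrite addr0 mul1r (eq_bigr (fun=> 1)) ?sumr_const // => w _.
  by apply: rphase0 => k; rewrite subrr.
by apply: (@sum_rphase _ k0); apply: affine_not_dvd; rewrite // eq_sym.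
Qed.

(** Each of the two parameters enters only one of the sums: averaging over [k0] leaves [x1 = x2],
    and averaging over [k1] leaves [x3 = x4]. *)
Lemma csum_fourth_moment (X X' : {set 'I_N}) (c c' : J -> int -> int) (k0 k1 : J) :
  affine_at c k0 -> (forall x, c' k0 x = 0) ->
  affine_at c' k1 -> (forall x, c k1 x = 0) ->
  \sum_(w : Omega) `|csum w X c| ^+ 2 * `|csum w X' c'| ^+ 2 =
  #|X|%:R * #|X'|%:R * #|{: Omega}|%:R.
Proof.
move=> aff c'0 aff' c0.
transitivity (\sum_(x1 in X) \sum_(x2 in X) \sum_(x3 in X') \sum_(x4 in X')
    \sum_(w : Omega) rphase w (fun k => c k (val x1)%:Z - c k (val x2)%:Z +
      (c' k (val x3)%:Z - c' k (val x4)%:Z))).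
  under eq_bigr => w _.
    rewrite !csum_norm2 mulr_suml.
    under eq_bigr => x1 _.
      rewrite mulr_suml.
      under eq_bigr => x2 _.
        rewrite mulr_sumr.
        under eq_bigr => x3 _.
          rewrite mulr_sumr.
          under eq_bigr => x4 _ do rewrite -rphaseD.
          over.
        over.
      over.
    over.
  rewrite exchange_big; apply: eq_bigr => x1 _.
  rewrite exchange_big; apply: eq_bigr => x2 _.
  rewrite exchange_big; apply: eq_bigr => x3 _.
  by rewrite exchange_big.
rewrite -mulrA -sumr_const mulr_suml; apply: eq_bigr => x1 x1X.
rewrite mul1r (bigD1 x1) //= [X in _ + X]big1 ?addr0 => [|x2 /andP[_ x12]]; last first.
  rewrite big1 // => x3 _; rewrite big1 // => x4 _.
  apply: (@sum_rphase _ k0); rewrite !c'0 subrr addr0.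
  by apply: affine_not_dvd; rewrite // eq_sym.
rewrite -sumr_const mulr_suml; apply: eq_bigr => x3 x3X.
rewrite mul1r (bigD1 x3) //= [X in _ + X]big1 ?addr0 => [|x4 /andP[_ x34]]; last first.
  apply: (@sum_rphase _ k1); rewrite !c0 subrr add0r.
  by apply: affine_not_dvd; rewrite // eq_sym.
rewrite (eq_bigr (fun=> 1)) ?sumr_const // => w _.
by apply: rphase0 => k; rewrite !subrr.
Qed.
End RandomPhases.

(** * The density *)



Section RealPart.
Local Open Scope complex_scope.
Variable R : rcfType.
Implicit Types x y : R[i].

Lemma ReD x y : Re (x + y) = Re x + Re y.
Proof. by case: x => xr xi; case: y => yr yi. Qed.

Lemma Re_sum (I : Type) (s : seq I) (P : pred I) (F : I -> R[i]) :
  Re (\sum_(i <- s | P i) F i) = \sum_(i <- s | P i) Re (F i).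
Proof. exact: (big_morph _ ReD). Qed.

Lemma Re_mulC (c : R) x : Re (c%:C * x) = c * Re x.
Proof. by case: x => u v /=; rewrite mul0r subr0. Qed.

Lemma Re_le x y : x <= y -> Re x <= Re y.
Proof. by rewrite lecE => /andP[]. Qed.

Lemma Re_le_norm x : Re x <= Re `|x|.
Proof.
by have /Re_le := normc_ge_Re x; rewrite /=; apply: le_trans; exact: ler_norm.
Qed.

Lemma Re_normM x y : Re `|x * y| = Re `|x| * Re `|y|.
Proof. by rewrite normrM [`|x|]normc_def Re_mulC. Qed.

Lemma Re_norm_realC (c : R) : Re `|c%:C| = `|c|.
Proof. by rewrite normc_def /= expr0n addr0 sqrtr_sqr. Qed.

Lemma Re_norm_ge0 x : 0 <= Re `|x|.
Proof. by have /Re_le := normr_ge0 x. Qed.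

Lemma Re_norm_sum (I : Type) (s : seq I) (P : pred I) (F : I -> R[i]) :
  Re `|\sum_(i <- s | P i) F i| <= \sum_(i <- s | P i) Re `|F i|.
Proof. by rewrite -Re_sum; apply: Re_le; exact: ler_norm_sum. Qed.

Lemma Re_normX x m : Re (`|x| ^+ m) = Re `|x| ^+ m.
Proof.
elim: m => [|m IHm]; first by rewrite !expr0.
by rewrite !exprS -IHm -normrX -normrM Re_normM.
Qed.

Lemma Re_nat (m : nat) : Re (m%:R : R[i]) = m%:R.
Proof. by rewrite -(rmorph_nat (real_complex R)). Qed.
End RealPart.

Lemma sum_le_card (R : numDomainType) (T : finType) (P : pred T) (F : T -> R)
    (B : R) : 0 <= B -> (forall t, P t -> F t <= B) ->
  \sum_(t | P t) F t <= #|T|%:R * B.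
Proof.
move=> B0 FB; apply: (@le_trans _ _ (\sum_(t : T) B)).
  by rewrite [leLHS]big_mkcond; apply: ler_sum => t _; case: ifP => // /FB.
by rewrite sumr_const mulr_natl.
Qed.

Lemma card_interval_le (m lo hi : nat) (A : {set 'I_m}) :
  (forall x, x \in A -> (lo <= x < hi)%N) -> (#|A| <= hi - lo)%N.
Proof.
move=> hA; rewrite cardE -(size_map val) -[leqRHS](size_iota lo).
apply: uniq_leq_size; first by rewrite map_inj_uniq ?enum_uniq //; exact: val_inj.
move=> y /mapP[x]; rewrite mem_enum => /hA /andP[lx xh] ->.
by rewrite mem_iota subnKC ?lx // ltnW // (leq_ltn_trans lx).
Qed.

Lemma card_interval_ge (m lo hi : nat) (A : {set 'I_m}) : (hi <= m)%N ->
  (forall x : 'I_m, (lo <= x < hi)%N -> x \in A) -> (hi - lo <= #|A|)%N.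
Proof.
move=> him hA; have [hl|lh] := leqP hi lo; first by rewrite (eqP hl).
rewrite cardE -(size_map val (enum _)) -[leqLHS](size_iota lo).
apply: uniq_leq_size; first exact: iota_uniq.
move=> y; rewrite mem_iota subnKC ?(ltnW lh) // => /andP[ly yh].
have ym : (y < m)%N by exact: leq_trans him.
apply/mapP; exists (Ordinal ym) => //.
by rewrite mem_enum hA //= ly.
Qed.

(** * The density as a combination of random quadratic characters *)

Section Construction.
Local Open Scope complex_scope.
Variables (R : rcfType) (k1 k2 k3 : int) (n K' : nat) (L : nat).
Local Notation C := R[i].
Local Notation K := K'.+1.
Local Notation N := (K * L)%N.
Local Notation pt := (pattern_pt 0 k1 k2 k3).
Local Notation phase := (phase 0 k1 k2 k3).
Local Notation V := ('I_K * 'I_n)%type.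
Local Notation J := (V * 'I_3)%type.
Local Notation opt := (option ('I_n * 'I_n * 'I_4)).
Variables (M : nat) (z : C) (eta : R) (a : nat -> R).
Hypothesis z_prim : M.-primitive_root z.
Local Notation Omega := {ffun J -> 'I_M}.

Definition block (p : int) : 'I_K := inord (`|p|%N %/ L).

Definition lift_edge (b : 'I_K) (e : opt) : option (V * V * 'I_4) :=
  omap (fun t => ((b, t.1.1), (b, t.1.2), t.2)) e.

(** The sign at colour 0 makes the product of the weights over the four colours negative. Loops,
    whose character is constant, get weight 0. *)
Definition weight (e : opt) : R :=
  if e is Some (i, i', j) then
    if i != i' then eta * (if j == 0%N :> nat then - a j else a j) else 0
  else 1.

Definition chi (w : Omega) (b : 'I_K) (e : opt) (p : int) : C :=
  rphase z w (fun k => inc (lift_edge b e) k.1 *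
                       phase k.2 (colour (lift_edge b e)) p).

Definition dens (w : Omega) (p : int) : C :=
  \sum_(e : opt) (weight e)%:C * chi w (block p) e p.

Definition in_range (d : int) : {set 'I_N} :=
  [set x : 'I_N | [forall r : 'I_4, (0 <= x%:Z + d * pt r < N%:Z)]].

Definition blocks (d : int) (x : 'I_N) : {ffun 'I_4 -> 'I_K} :=
  [ffun r : 'I_4 => block (x%:Z + d * pt r)].

Definition typed (d : int) (beta : {ffun 'I_4 -> 'I_K}) : {set 'I_N} :=
  [set x in in_range d | blocks d x == beta].

Definition cf (d : int) (beta : {ffun 'I_4 -> 'I_K}) (o : {ffun 'I_4 -> opt})
    (k : J) (x : int) : int :=
  coef 0 k1 k2 k3 d (fun r => lift_edge (beta r) (o r)) k.2 k.1 x.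

Definition pattern_term (w : Omega) (d : int) (beta : {ffun 'I_4 -> 'I_K})
    (o : {ffun 'I_4 -> opt}) : C :=
  csum z w (typed d beta) (cf d beta o).

Definition oweight (o : {ffun 'I_4 -> opt}) : R := \prod_(r < 4) weight (o r).

Lemma prod_rphase (w : Omega) (I : Type) (s : seq I) (A : I -> J -> int) :
  \prod_(i <- s) rphase z w (A i) = rphase z w (fun k => \sum_(i <- s) A i k).
Proof.
elim: s => [|i s IHs].
  by rewrite big_nil rphase0 // => k; rewrite big_nil.
rewrite big_cons IHs -(rphaseD z_prim) /rphase /dot; congr (_ ^ _).
by apply: eq_bigr => k _; rewrite big_cons.
Qed.

Lemma prod_chi (w : Omega) (d : int) (beta : {ffun 'I_4 -> 'I_K})
    (o : {ffun 'I_4 -> opt}) (x : int) :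
  \prod_(r < 4) chi w (beta r) (o r) (x + d * pt r) =
  rphase z w (fun k => cf d beta o k x).
Proof. by rewrite prod_rphase. Qed.

(** Patterns are sorted by the blocks of their four points, and in each class the product of four
    sums of characters is expanded. *)
Lemma pattern_expansion (w : Omega) (d : int) :
  \sum_(x in in_range d) \prod_(r < 4) dens w (x%:Z + d * pt r) =
  \sum_(beta : {ffun 'I_4 -> 'I_K}) \sum_(o : {ffun 'I_4 -> opt})
    (oweight o)%:C * pattern_term w d beta o.
Proof.
rewrite (partition_big (blocks d) predT) //=; apply: eq_bigr => beta _.
transitivity (\sum_(x in typed d beta) \sum_(o : {ffun 'I_4 -> opt})
    (oweight o)%:C * rphase z w (fun k => cf d beta o k (val x)%:Z)).
  apply: eq_big => [x|x /andP[_ /eqP bx]]; first by rewrite !inE.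
  rewrite /dens bigA_distr_bigA /=; apply: eq_bigr => o _.
  rewrite big_split /= -prod_chi /oweight rmorph_prod; congr (_ * _).
  by apply: eq_bigr => r _; rewrite -bx ffunE.
rewrite exchange_big /=; apply: eq_bigr => o _.
by rewrite -mulr_sumr.
Qed.

Definition swap_edge (e : opt) : opt := omap (fun t => ((t.1.2, t.1.1), t.2)) e.

Lemma swap_edgeK : involutive swap_edge.
Proof. by case=> [[[i i'] j]|]. Qed.

Lemma weight_swap (e : opt) : weight (swap_edge e) = weight e.
Proof. by case: e => [[[i i'] j]|] //=; rewrite eq_sym. Qed.

Lemma chi_swap (w : Omega) b e p : chi w b (swap_edge e) p = (chi w b e p)^*%R.
Proof.
rewrite -(rphaseN z_prim) /chi; congr (z ^ _); apply: eq_bigr => k _.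
by congr (_ * _); case: e => [[[i i'] j]|] /=; rewrite ?mul0r ?oppr0 // -mulNr opprB.
Qed.

(** Exchanging the ends of an edge conjugates its character and keeps its weight. *)
Lemma dens_real (w : Omega) (p : int) : dens w p \is Num.real.
Proof.
apply/CrealP; rewrite /dens rmorph_sum /= (reindex_inj (inv_inj swap_edgeK)) /=.
apply: eq_bigr => e _; rewrite weight_swap chi_swap rmorphM /= conjCK.
by congr (_ * _); apply/CrealP; apply/complex_realP; exists (weight e).
Qed.


Hypotheses (k01 : 0 < k1) (k12 : k1 < k2) (k23 : k2 < k3).
Hypothesis nonparallel : 0 + k3 != k1 + k2.
Variable e : R.
Hypothesis e_gt0 : 0 < e.
Hypothesis eta_gt0 : 0 < eta.
Hypothesis a_ok : amplitude_ok e (colour_resonance 0 k1 k2 k3) a.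

Definition main_weight : R := eta ^+ 4 * \prod_(j < 4) a j.

Lemma main_weight_gt0 : 0 < main_weight.
Proof.
case: a_ok => a01 _ _; rewrite mulr_gt0 ?exprn_gt0 //.
by apply: prodr_gt0 => j _; case/andP: (a01 j).
Qed.

Definition perm_edges (t : 'I_n * 'I_n * {perm 'I_4}) : {ffun 'I_4 -> opt} :=
  [ffun r => Some (t.1.1, t.1.2, t.2 r)].

Lemma perm_edges_inj : injective perm_edges.
Proof.
move=> [[i i'] s] [[l l'] t] /ffunP h.
have h0 := h ord0; rewrite !ffunE /= in h0; case: h0 => -> -> _.
by congr (_, _); apply/permP => r; have := h r; rewrite !ffunE /= => -[].
Qed.

Lemma oweight_perm (t : 'I_n * 'I_n * {perm 'I_4}) : t.1.1 != t.1.2 ->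
  oweight (perm_edges t) = - main_weight.
Proof.
case: t => [[i i'] s] /= ii'; rewrite /oweight.
transitivity (\prod_(r < 4)
    (eta * (if s r == 0%N :> nat then - a (s r) else a (s r)))).
  by apply: eq_bigr => r _; rewrite ffunE /= ii'.
rewrite -(reindex_inj (@perm_inj _ s) (F := fun j : 'I_4 =>
   eta * (if j == 0%N :> nat then - a j else a j)) (P := predT)) /=.
by rewrite /main_weight !big_ord_recl !big_ord0 /=; ring.
Qed.

(** The phase contributed by the single polynomial [(b, i)] when the points carry the colours in the
    order [s]. *)
Definition branch (w : Omega) (d : int) (b : 'I_K) (x : int) (s : {perm 'I_4})
    (i : 'I_n) : C :=
  rphase z w (fun k => (k.1 == (b, i))%:R *
    \sum_(r < 4) phase k.2 (s r) (x + d * pt r)).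

Lemma rphase_perm (w : Omega) d b x (t : 'I_n * 'I_n * {perm 'I_4}) :
  rphase z w (fun k => cf d [ffun=> b] (perm_edges t) k x) =
  branch w d b x t.2 t.1.1 * (branch w d b x t.2 t.1.2)^*%R.
Proof.
rewrite -(rphaseN z_prim) -(rphaseD z_prim) /rphase; congr (z ^ _).
apply: eq_bigr => k _; congr (_ * _); rewrite /cf /coef.
rewrite -mulNr -mulrDl mulr_sumr; apply: eq_bigr => r _.
by rewrite !ffunE /= !(eq_sym k.1).
Qed.

Lemma branch_id (w : Omega) d b x i : branch w d b x 1%g i = 1.
Proof.
apply: rphase0 => k; under eq_bigr => r _ do rewrite perm1.
by rewrite phase_pattern mulr0.
Qed.

Lemma sum_branches (w : Omega) d b x s :
  Re (\sum_(i : 'I_n) \sum_(i' : 'I_n | i != i')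
     branch w d b x s i * (branch w d b x s i')^*%R) =
  Re (`|\sum_(i : 'I_n) branch w d b x s i| ^+ 2) - n%:R.
Proof.
suff -> : \sum_(i : 'I_n) \sum_(i' : 'I_n | i != i')
     branch w d b x s i * (branch w d b x s i')^*%R =
    `|\sum_(i : 'I_n) branch w d b x s i| ^+ 2 - n%:R.
  by rewrite ReD; congr (_ + _); rewrite -(rmorph_nat (real_complex R)) -rmorphN.
apply/eqP; rewrite eq_sym subr_eq addrC; apply/eqP.
transitivity (\sum_(i < n) (1 + \sum_(i' < n | i != i')
     branch w d b x s i * (branch w d b x s i')^*%R)).
  rewrite normCK rmorph_sum mulr_suml.
  apply: eq_bigr => i _; rewrite mulr_sumr (bigD1 i) //=; congr (_ + _).
    by rewrite -normCK (rphase_norm z_prim) expr1n.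
  by apply: eq_bigl => i'; rewrite eq_sym.
by rewrite big_split /= sumr_const card_ord.
Qed.

(** For each of the 24 orders of the colours the pairs [i != i'] sum to at least [- n], by
    [sum_branches]; for the identity order every branch is 1 and they sum to [n ^ 2 - n]. *)
Lemma perm_sum_bound (w : Omega) d b x :
  \sum_t Re ((oweight (perm_edges t))%:C *
     rphase z w (fun k => cf d [ffun=> b] (perm_edges t) k x)) <=
  - main_weight * (n%:R ^+ 2 - 24 * n%:R).
Proof.
pose G s := \sum_(i : 'I_n) \sum_(i' : 'I_n | i != i')
     branch w d b x s i * (branch w d b x s i')^*%R.
have -> : \sum_t Re ((oweight (perm_edges t))%:C *
     rphase z w (fun k => cf d [ffun=> b] (perm_edges t) k x)) =
     \sum_s - main_weight * Re (G s).
  transitivity (\sum_(p : 'I_n * 'I_n) \sum_s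
      Re ((oweight (perm_edges (p, s)))%:C *
     rphase z w (fun k => cf d [ffun=> b] (perm_edges (p, s)) k x))).
    by rewrite pair_big; apply: eq_bigr => -[p s] _.
  rewrite exchange_big /=; apply: eq_bigr => s _.
  rewrite -Re_mulC /G mulr_sumr Re_sum -(pair_big predT predT
    (fun i i' => Re ((oweight (perm_edges (i, i', s)))%:C *
     rphase z w (fun k => cf d [ffun=> b] (perm_edges (i, i', s)) k x)))) /=.
  apply: eq_bigr => i _; rewrite mulr_sumr Re_sum [RHS]big_mkcond /=.
  apply: eq_bigr => i' _; rewrite rphase_perm /=; case: ifPn => ii'.
    by rewrite oweight_perm.
  rewrite Re_mulC /oweight big_ord_recl ffunE /= (negPf ii').
  by rewrite !mul0r.
rewrite (bigD1 (1%g : {perm 'I_4})) //= -mulr_sumr -mulrDr ler_nM2l ?oppr_lt0 ?main_weight_gt0 //.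
have -> : Re (G 1%g) = n%:R ^+ 2 - n%:R.
  rewrite sum_branches; under eq_bigr => i _ do rewrite branch_id.
  by rewrite sumr_const card_ord normr_nat -natrX Re_nat natrX.
have Gge s : - n%:R <= Re (G s).
  by rewrite sum_branches lerDr Re_normX exprn_ge0 // Re_norm_ge0.
have : - (23 * n%:R) <= \sum_(s : {perm 'I_4} | s != 1%g) Re (G s).
  apply: le_trans (ler_sum _ (fun s _ => Gge s)).
  by rewrite sumr_const cardC1 card_Sn mulNrn mulrC mulr_natr.
lra.
Qed.


Definition perm_type (o : {ffun 'I_4 -> opt}) : bool :=
  o \in [set perm_edges t | t in setT].

(** Covers the third case of [edges_trichotomy]: two vertices, then a direction and a colour for
    each edge. This leaves at most [4096 * n ^ 2] configurations. *)
Definition two_cycles (t : 'I_n * 'I_n * {ffun 'I_4 -> bool * 'I_4}) :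
    {ffun 'I_4 -> opt} :=
  [ffun r => Some (if (t.2 r).1 then (t.1.1, t.1.2, (t.2 r).2)
                   else (t.1.2, t.1.1, (t.2 r).2))].

Definition resonant_type (o : {ffun 'I_4 -> opt}) : bool :=
  (o \in [set two_cycles t | t in setT]) && (`|oweight o| <= e * main_weight).

Lemma main_pointwise (w : Omega) d b x :
  \sum_(o | perm_type o || resonant_type o) Re ((oweight o)%:C *
     rphase z w (fun k => cf d [ffun=> b] o k x)) <=
  - main_weight * (n%:R ^+ 2 - 24 * n%:R - 4096 * e * n%:R ^+ 2).
Proof.
have -> : - main_weight * (n%:R ^+ 2 - 24 * n%:R - 4096 * e * n%:R ^+ 2) =
    - main_weight * (n%:R ^+ 2 - 24 * n%:R) +
    (n * n * 8 ^ 4)%N%:R * (e * main_weight) by rewrite natrM (natrM _ n n) natrX; ring.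
rewrite (bigID perm_type) /=; apply: lerD.
  apply: le_trans (perm_sum_bound w d b x).
  rewrite (eq_bigl perm_type) => [|o]; last by rewrite andb_idl // => ->.
  rewrite big_imset /= => [|t t' _ _]; last exact: perm_edges_inj.
  by rewrite le_eqVlt; apply/orP; left; apply/eqP; apply: eq_bigl => t; rewrite inE.
apply: (@le_trans _ _ (\sum_(o | resonant_type o) (e * main_weight))).
  rewrite [leLHS]big_mkcond [leRHS]big_mkcond /=; apply: ler_sum => o _.
  have em0 : 0 <= e * main_weight by rewrite mulr_ge0 ?ltW ?main_weight_gt0.
  case: (perm_type o) => /=; first by case: ifP.
  rewrite andbT; case: ifP => // /andP[_ wo].
  apply: le_trans wo; apply: le_trans (Re_le_norm _) _.
  by rewrite Re_normM Re_norm_realC (rphase_norm z_prim) mulr1.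
rewrite sumr_const -[leLHS]mulr_natl; apply: ler_wpM2r.
  by rewrite mulr_ge0 ?ltW ?main_weight_gt0.
rewrite ler_nat; apply: (@leq_trans #|[set two_cycles t | t in setT]|).
  by apply: subset_leq_card; apply/subsetP => o /andP[].
apply: leq_trans (leq_imset_card _ _) _.
by rewrite cardsT !card_prod card_ffun card_prod card_bool !card_ord.
Qed.

(** * Steady terms and shaking terms *)

Definition steady (beta : {ffun 'I_4 -> 'I_K}) (o : {ffun 'I_4 -> opt}) : bool :=
  [exists b, beta == [ffun=> b]] && (perm_type o || resonant_type o).

(** Steady terms may have constant phase and are bounded pointwise by [main_pointwise]; shaking
    terms cancel in mean square over the random parameters. *)
Definition shaking (d : int) (beta : {ffun 'I_4 -> 'I_K})
    (o : {ffun 'I_4 -> opt}) : bool :=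
  [exists k : J, moving 0 k1 k2 k3 d (fun r => lift_edge (beta r) (o r)) k.2 k.1].

Lemma weight_abs (b : 'I_K) (f : opt) : f != None -> weight f != 0 ->
  `|weight f| = eta * a (colour (lift_edge b f)).
Proof.
case: f => [[[i i'] j]|] //= _; case: ifP => [_ _|]; last by rewrite eqxx.
case: a_ok => a01 _ _; have /andP[a0 _] := a01 j.
rewrite normrM (gtr0_norm eta_gt0); congr (_ * _).
by case: ifP; rewrite ?normrN gtr0_norm.
Qed.

(** This is [edges_trichotomy] for the lifted edges. A lifted edge stays in its block, so edges
    joining the same two vertices have the same block. *)
Lemma steady_or_shaking (d : int) beta (o : {ffun 'I_4 -> opt}) : d != 0 ->
  o != [ffun=> None] -> oweight o != 0 -> steady beta o || shaking d beta o.
Proof.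
move=> d0 oN wo.
have wr r : weight (o r) != 0.
  by move: wo; rewrite /oweight prodf_seq_neq0 => /allP/(_ r); apply; rewrite mem_index_enum.
pose o' r := lift_edge (beta r) (o r).
have lo r : loopless (o' r).
  have := wr r; rewrite /o'; case: (o r) => [[[i i'] j]|] //=.
  by rewrite xpair_eqE eqxx /=; case: (i != i') => //; rewrite eqxx.
have liftE r A B j : o' r = Some (A, B, j) ->
    beta r = A.1 /\ o r = Some (A.2, B.2, j).
  by rewrite /o'; case: (o r) => [[[i i'] l]|] //= [<- <- <-].
have ex : exists r, o' r != None.
  have : ~~ [forall r, o r == None].
    by apply: contraNN oN => /forallP h; apply/eqP/ffunP => r; rewrite ffunE; apply/eqP.
  by rewrite negb_forall => /existsP[r hr]; exists r; rewrite /o'; case: (o r) hr.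
have [[t [v mv]]|[A [B [tau h]]]|[A [B [h [u [v [uv res prodE]]]]]]] :=
    edges_trichotomy k01 k12 k23 nonparallel lo a d0 ex.
- by apply/orP; right; apply/existsP; exists (v, t).
- apply/orP; left; apply/andP; split.
    apply/existsP; exists A.1; apply/eqP/ffunP => r; rewrite ffunE.
    by have [-> _] := liftE _ _ _ _ (h r).
  apply/orP; left; apply/imsetP; exists (A.2, B.2, tau) => //.
  by apply/ffunP => r; rewrite ffunE; have [_ ->] := liftE _ _ _ _ (h r).
apply/orP; left; apply/andP; split.
  have AB : A.1 = B.1.
    have := h ord0; rewrite /o'; case: (o ord0) => [[[i i'] l]|] /= [] // [<- <-] //.
  apply/existsP; exists A.1; apply/eqP/ffunP => r; rewrite ffunE.
  by case: (h r) => /liftE[-> _] //.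
apply/orP; right; apply/andP; split.
  apply/imsetP; exists (A.2, B.2, [ffun r => (o' r == Some (A, B, colour (o' r)), colour (o' r))]) => //.
  apply/ffunP => r; rewrite !ffunE /=; case: eqP => [/liftE[_ ->]//|ne].
  by case: (h r) => // /liftE[_ ->].
rewrite /oweight normr_prod.
have -> : \prod_(r < 4) `|weight (o r)| = \prod_(r < 4) (eta * a (colour (o' r))).
  apply: eq_bigr => r _; apply: weight_abs => //.
  by case: (h r) => /liftE[_ ->].
rewrite big_split /= prodr_const card_ord prodE /main_weight [leRHS]mulrCA ler_pM2l ?exprn_gt0 //.
by case: a_ok => _ _; exact.
Qed.

Local Notation ptype := ({ffun 'I_4 -> 'I_K} * {ffun 'I_4 -> opt})%type.
Local Notation slope_of d p k := (slope 0 k1 k2 k3 d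
  (fun r => lift_edge (p.1 r) (p.2 r)) k.2 k.1).

Definition dval (i : 'I_(2 * N)) : int := i%:Z - N%:Z.

Hypothesis M_large : forall (i : 'I_(2 * N)) (p : ptype) (k : J),
  `|slope_of (dval i) p k| * N%:Z < M%:Z.

Lemma inc_lift_out (b : 'I_K) (f : opt) (v : V) : v.1 != b ->
  inc (lift_edge b f) v = 0.
Proof.
case: v => b' i; case: f => [[[i1 i2] j]|] //= bb'.
by rewrite !xpair_eqE eq_sym (negPf bb').
Qed.

(** Parameters of blocks that the pattern does not meet have slope 0, so the moving one belongs to a
    block that is met. Types without a common block therefore have moving parameters foreign to each
    other. *)
Lemma shaking_affine (i : 'I_(2 * N)) (p : ptype) : shaking (dval i) p.1 p.2 ->
  exists2 k : J, affine_at M N (cf (dval i) p.1 p.2) k &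
    exists r, p.1 r = k.1.1.
Proof.
case/existsP => k mv; exists k.
  exists (slope_of (dval i) p k); first by rewrite M_large andbT; case/andP: mv.
  by move=> x x'; exact: moving_coef.
have /andP[sl _] := mv.
case: (boolP [exists r, p.1 r == k.1.1]) => [/existsP[r /eqP hr]|/existsPn h].
  by exists r.
have inc0 r : inc (lift_edge (p.1 r) (p.2 r)) k.1 = 0.
  by apply: inc_lift_out; rewrite eq_sym; exact: h.
move: sl; rewrite /slope !big1 => [|r _|r _|r _]; rewrite ?inc0 ?mul0r //.
by rewrite mulr0; case: k.2 => [[|[|[|//]]] ?].
Qed.

Definition disjoint_types (p q : ptype) : bool :=
  [forall r, [forall s, p.1 r != q.1 s]].

Lemma disjoint_typesC p q : disjoint_types p q = disjoint_types q p.
Proof.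
by apply/forallP/forallP => h r; apply/forallP => s;
  rewrite eq_sym; exact: (forallP (h s)).
Qed.

Lemma cf_disjoint (d : int) (p q : ptype) (k : J) (x : int) :
  disjoint_types p q -> (exists r, p.1 r = k.1.1) -> cf d q.1 q.2 k x = 0.
Proof.
move=> dis [r hr]; rewrite /cf /coef big1 // => s _.
by rewrite inc_lift_out ?mul0r // -hr; exact: (forallP (forallP dis r)).
Qed.

Definition size_of (w : Omega) (d : int) (p : ptype) : R :=
  Re `|pattern_term w d p.1 p.2|.

Lemma typed_card d beta : (#|typed d beta| <= N)%N.
Proof. by rewrite -[X in (_ <= X)%N]card_ord max_card. Qed.

Lemma size_second_moment (i : 'I_(2 * N)) (p : ptype) :
  shaking (dval i) p.1 p.2 ->
  \sum_(w : Omega) size_of w (dval i) p ^+ 2 <= N%:R * #|{: Omega}|%:R.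
Proof.
case/shaking_affine => k aff _.
have := congr1 (@complex.Re R) (csum_second_moment z_prim (typed (dval i) p.1) aff).
rewrite Re_sum -natrM Re_nat.
under eq_bigr => w _ do rewrite Re_normX.
by move=> ->; rewrite -natrM ler_nat leq_mul2r typed_card orbT.
Qed.

Lemma size_fourth_moment (i : 'I_(2 * N)) (p q : ptype) :
  shaking (dval i) p.1 p.2 -> shaking (dval i) q.1 q.2 -> disjoint_types p q ->
  \sum_(w : Omega) size_of w (dval i) p ^+ 2 * size_of w (dval i) q ^+ 2 <=
    N%:R ^+ 2 * #|{: Omega}|%:R.
Proof.
move=> /shaking_affine[k aff inp] /shaking_affine[l aff' inq] dis.
have dis' := dis; rewrite disjoint_typesC in dis'.
have := congr1 (@complex.Re R) (csum_fourth_moment z_prim (typed (dval i) p.1)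
  (typed (dval i) q.1) aff (fun x => cf_disjoint _ x dis inp) aff'
  (fun x => cf_disjoint _ x dis' inq)).
rewrite Re_sum -!natrM Re_nat.
under eq_bigr => w _ do rewrite -!normrX -normrM Re_normM !normrX !Re_normX.
move=> ->; rewrite -natrX -natrM ler_nat leq_mul2r expnS expn1.
by rewrite leq_mul ?typed_card ?orbT.
Qed.

Definition selection_const : R :=
  2 * #|{: ptype}|%:R ^+ 2 + #|{: ptype}|%:R.

(** Summing over [2 * N] differences costs a factor [N], after which a second moment gives no more
    than the trivial bound. For two types on disjoint blocks the mean of the product of squared
    sizes is at most [N ^ 2], which still leaves [N ^ 3] against the trivial [N ^ 4]. The single
    difference 0, needed for the mean of the density, is handled by second moments. *)
Lemma selection : (0 < N)%N -> exists w : Omega,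
  (forall (i : 'I_(2 * N)) (p q : ptype), shaking (dval i) p.1 p.2 ->
     shaking (dval i) q.1 q.2 -> disjoint_types p q ->
     size_of w (dval i) p ^+ 2 * size_of w (dval i) q ^+ 2 <=
       selection_const * N%:R ^+ 3) /\
  (forall p : ptype, shaking 0 p.1 p.2 ->
     size_of w 0 p ^+ 2 <= selection_const * N%:R).
Proof.
move=> N0; have N0R : 0 < N%:R :> R by rewrite ltr0n.
have i0lt : (N < 2 * N)%N by lia.
pose i0 : 'I_(2 * N) := Ordinal i0lt.
have d0 : dval i0 = 0 by rewrite /dval subrr.
pose adm (t : 'I_(2 * N) * ptype * ptype) := [&& shaking (dval t.1.1) t.1.2.1 t.1.2.2,
   shaking (dval t.1.1) t.2.1 t.2.2 & disjoint_types t.1.2 t.2].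
pose G (w : Omega) (t : 'I_(2 * N) * ptype * ptype) :=
  size_of w (dval t.1.1) t.1.2 ^+ 2 * size_of w (dval t.1.1) t.2 ^+ 2.
(* The factor [N ^ 2] brings the second moments for the difference 0 to the common scale [N ^ 3]. *)
pose F (w : Omega) := \sum_(t | adm t) G w t +
  N%:R ^+ 2 * \sum_(p : ptype | shaking (dval i0) p.1 p.2) size_of w (dval i0) p ^+ 2.
have O0 : (0 < #|{: Omega}|)%N.
  by rewrite card_ffun expn_gt0 card_ord (prim_order_gt0 z_prim).
have [|w Fw] := @exists_le_average R _ F (selection_const * N%:R ^+ 3) O0.
  rewrite /F big_split /=.
  have -> : #|{: Omega}|%:R * (selection_const * N%:R ^+ 3) =
      (2 * N * #|{: ptype}| * #|{: ptype}|)%N%:R * (N%:R ^+ 2 * #|{: Omega}|%:R) +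
      N%:R ^+ 2 * (#|{: ptype}|%:R * (N%:R * #|{: Omega}|%:R)) :> R.
    rewrite /selection_const (natrM _ _ #|{: ptype}|) (natrM _ (2 * N)).
    by rewrite (natrM _ 2); ring.
  have c2 : 0 <= N%:R ^+ 2 * #|{: Omega}|%:R :> R by rewrite mulr_ge0 ?sqr_ge0.
  have c1 : 0 <= N%:R * #|{: Omega}|%:R :> R by rewrite mulr_ge0 ?sqr_ge0.
  apply: lerD; last first.
    rewrite -mulr_sumr exchange_big /= ler_wpM2l ?sqr_ge0 //.
    apply: sum_le_card => // p.
    exact: size_second_moment.
  have -> : (2 * N * #|{: ptype}| * #|{: ptype}|)%N =
      #|{: 'I_(2 * N) * ptype * ptype}| by rewrite !card_prod !card_ord.
  rewrite exchange_big /=.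
  by apply: sum_le_card => // t /and3P[h1 h2 h3]; exact: size_fourth_moment.
have G_ge0 t : 0 <= G w t by rewrite mulr_ge0 ?sqr_ge0.
have second_ge0 : 0 <= N%:R ^+ 2 * \sum_(p : ptype | shaking (dval i0) p.1 p.2)
    size_of w (dval i0) p ^+ 2 :> R.
  by rewrite mulr_ge0 ?sqr_ge0 // sumr_ge0 // => p _; rewrite sqr_ge0.
exists w; split=> [i p q hp hq dis|p hp].
  apply: le_trans Fw; rewrite /F (bigD1 (i, p, q)) /=; last by rewrite /adm hp hq.
  by rewrite -addrA lerDl addr_ge0 // sumr_ge0.
rewrite -d0 in hp *; rewrite -(@ler_pM2l _ (N%:R ^+ 2)) ?exprn_gt0 //.
have -> : N%:R ^+ 2 * (selection_const * N%:R) = selection_const * N%:R ^+ 3 by ring.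
apply: le_trans Fw; apply: ler_wpDl; first exact: sumr_ge0.
rewrite ler_pM2l ?exprn_gt0 // (bigD1 p) //= lerDl.
by apply: sumr_ge0 => q _; rewrite sqr_ge0.
Qed.

(** * Counting patterns by blocks *)

Definition reach (d : int) : nat := (`|d| * `|k3|)%N.

Lemma pt_range (r : 'I_4) : 0 <= pt r <= k3.
Proof.
by move: k01 k12 k23; case: r => [[|[|[|[|//]]]] ?]; rewrite /pattern_pt /=; lia.
Qed.

Lemma shift_range (d : int) (r : 'I_4) :
  (0 <= d -> 0 <= d * pt r <= (reach d)%:Z) /\
  (d <= 0 -> - (reach d)%:Z <= d * pt r <= 0).
Proof.
have := pt_range r; rewrite /reach; move: (pt r) k01 k12 k23 => q h1 h2 h3 /andP[q0 qk].
have k30 : (`|k3|%N)%:Z = k3 by lia.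
rewrite PoszM k30; split=> d0.
  have -> : (`|d|%N)%:Z = d by lia.
  by rewrite mulr_ge0 //= ler_wpM2l.
have -> : (`|d|%N)%:Z = - d by lia.
by rewrite mulNr opprK mulr_le0_ge0 // andbT ler_wnM2l.
Qed.

Lemma pt3 : pt (inord 3 : 'I_4) = k3.
Proof. by rewrite inordK. Qed.

Lemma in_range_card (d : int) : (#|in_range d| <= N - reach d)%N.
Proof.
have dk3 : 0 <= d /\ d * k3 = (reach d)%:Z \/ d <= 0 /\ d * k3 = - (reach d)%:Z.
  have k30 : (`|k3|%N)%:Z = k3 by move: k01 k12 k23; lia.
  rewrite /reach PoszM k30; have [h|h] := lerP 0 d.
    by left; split=> //; have -> : (`|d|%N)%:Z = d by lia.
  right; split; first exact: ltW.
  by have -> : (`|d|%N)%:Z = - d by [lia]; rewrite mulNr opprK.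
have last x : x \in in_range d -> 0 <= x%:Z + d * k3 < N%:Z.
  by rewrite inE => /forallP/(_ (inord 3)); rewrite pt3.
case: dk3 => -[_ dk3].
  rewrite -[X in (_ <= X)%N]subn0; apply: card_interval_le => x /last.
  by rewrite dk3; lia.
apply: card_interval_le => x /last; rewrite dk3; have := ltn_ord x; lia.
Qed.

Lemma blockP (p : int) (b : 'I_K) : (0 < L)%N -> 0 <= p < N%:Z ->
  (block p == b) = ((b * L)%:Z <= p < (b * L)%:Z + L%:Z).
Proof.
move=> L0 /andP[p0 pN]; have [q pq] : exists q : nat, p = q%:Z by exists `|p|%N; lia.
rewrite {p p0}pq in pN *; rewrite /block absz_nat -val_eqE /= inordK; last first.
  by rewrite ltn_divLR // -ltz_nat.
rewrite -PoszD lez_nat ltz_nat; apply/eqP/idP => [<-|/andP[h1 h2]].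
  by rewrite leq_divM /= -mulSnr ltn_ceil.
by apply/eqP; rewrite eqn_leq -ltnS ltn_divLR // mulSnr h2 leq_divRL.
Qed.

Lemma typed_const_card (d : int) (b : 'I_K) : (0 < L)%N ->
  (L - reach d <= #|typed d [ffun=> b]|)%N.
Proof.
move=> L0; have bN : (b * L + L <= N)%N by rewrite -mulSnr leq_mul2r ltn_ord orbT.
have inside (x : 'I_N) : (forall r : 'I_4, (b * L)%:Z <= x%:Z + d * pt r < (b * L)%:Z + L%:Z) ->
    x \in typed d [ffun=> b].
  move=> h; have rng (r : 'I_4) : 0 <= x%:Z + d * pt r < N%:Z.
    by have := h r; move: bN (d * _) => bN y; lia.
  rewrite !inE; apply/andP; split; first by apply/forallP.
  by apply/eqP/ffunP => r; rewrite !ffunE; apply/eqP; rewrite blockP.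
have [d0|d0] := lerP 0 d.
  have -> : (L - reach d = (b * L + L - reach d) - b * L)%N by lia.
  apply: card_interval_ge => [|x hx]; first by lia.
  apply: inside => r; have [/(_ d0) + _] := shift_range d r; lia.
have -> : (L - reach d = (b * L + L) - (b * L + reach d))%N by lia.
apply: card_interval_ge => [//|x hx].
apply: inside => r; have [_ /(_ (ltW d0))] := shift_range d r; lia.
Qed.

Definition touching (d : int) (B : {set 'I_K}) : {set 'I_N} :=
  [set x in in_range d | [exists r, blocks d x r \in B]].

Lemma touching_card (d : int) (B : {set 'I_K}) : (0 < L)%N ->
  (#|touching d B| <= #|B| * (L + reach d))%N.
Proof.
move=> L0.
have one (b : 'I_K) : (#|[set x in in_range d | [exists r, blocks d x r == b]]| <= L + reach d)%N.
  have near x : x \in [set x in in_range d | [exists r, blocks d x r == b]] ->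
      exists r : 'I_4, (b * L)%:Z <= x%:Z + d * pt r < (b * L)%:Z + L%:Z.
    rewrite !inE => /andP[/forallP rng /existsP[r]]; rewrite ffunE => hb.
    by exists r; rewrite -blockP.
  have [d0|d0] := lerP 0 d.
    apply: (@leq_trans ((b * L + L) - (b * L - reach d))); last by lia.
    apply: card_interval_le => x /near[r]; have [/(_ d0) + _] := shift_range d r; lia.
  apply: (@leq_trans ((b * L + L + reach d) - b * L)); last by lia.
  apply: card_interval_le => x /near[r]; have [_ /(_ (ltW d0))] := shift_range d r; lia.
apply: (@leq_trans (\sum_(b in B) #|[set x in in_range d | [exists r, blocks d x r == b]]|)).
  have cardE (S : {set 'I_N}) : #|S| = (\sum_x (x \in S))%N.
    by rewrite -sum1_card big_mkcond.
  rewrite cardE (eq_bigr _ (fun b _ => cardE _)).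
  rewrite exchange_big /=; apply: leq_sum => x _.
  case: (boolP (x \in touching d B)) => // hx.
  have [b bB xb] : exists2 b, b \in B &
      x \in [set x in in_range d | [exists r, blocks d x r == b]].
    move: hx; rewrite inE => /andP[xd /existsP[r rB]]; exists (blocks d x r) => //.
    by rewrite inE xd; apply/existsP; exists r.
  by rewrite (bigD1 b) //= xb.
rewrite -sum_nat_const; apply: leq_sum => b _; exact: one.
Qed.

Definition total_weight : R := \sum_(f : opt | f != None) `|weight f|.

Lemma sum_oweight :
  \sum_(o : {ffun 'I_4 -> opt} | o != [ffun=> None]) `|oweight o| =
  (1 + total_weight) ^+ 4 - 1.
Proof.
have -> : (1 + total_weight) ^+ 4 = \sum_(o : {ffun 'I_4 -> opt}) `|oweight o|.
  have -> : 1 + total_weight = \sum_f `|weight f|.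
    by rewrite (bigD1 None) //= normr1.
  transitivity (\prod_(r < 4) \sum_f `|weight f|).
    by rewrite prodr_const card_ord.
  rewrite bigA_distr_bigA /=.
  by apply: eq_bigr => o _; rewrite /oweight normr_prod.
have w1 : oweight [ffun=> None] = 1 by rewrite /oweight big1 // => r _; rewrite ffunE.
by rewrite [in RHS](bigD1 [ffun=> None]) //= w1 normr1 addrAC subrr add0r.
Qed.

Definition selected (w : Omega) (B : R) : Prop :=
  forall (i : 'I_(2 * N)) (p q : ptype), shaking (dval i) p.1 p.2 ->
     shaking (dval i) q.1 q.2 -> disjoint_types p q ->
     size_of w (dval i) p ^+ 2 * size_of w (dval i) q ^+ 2 <= B ^+ 4.

(** [E] consists of the blocks of a shaking type of largest size. A shaking type avoiding [E] is
    disjoint from it and not larger, so the fourth power of its size is at most the selected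
    product. *)
Lemma exceptional_blocks (w : Omega) (B : R) (i : 'I_(2 * N)) : 0 <= B ->
  selected w B -> exists2 E : {set 'I_K}, (#|E| <= 4)%N &
    forall p : ptype, shaking (dval i) p.1 p.2 -> (forall r, p.1 r \notin E) ->
      size_of w (dval i) p <= B.
Proof.
move=> B0 sel.
case: (boolP [exists p : ptype, shaking (dval i) p.1 p.2]) => [/existsP[p0 hp0]|/existsPn no]; last first.
  by exists set0 => [|p hp]; [rewrite cards0 | have := no p; rewrite hp].
pose q := [arg max_(p > p0 | shaking (dval i) p.1 p.2) size_of w (dval i) p]%O.
have [hq qmax] : shaking (dval i) q.1 q.2 /\
    forall p : ptype, shaking (dval i) p.1 p.2 -> size_of w (dval i) p <= size_of w (dval i) q.
  by rewrite /q; case: Order.TotalTheory.arg_maxP => // q' hq' m; split.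
exists [set q.1 r | r in 'I_4].
  by apply: leq_trans (leq_imset_card _ _) _; rewrite card_ord.
move=> p hp pE; have dis : disjoint_types p q.
  apply/forallP => r; apply/forallP => s; apply: contra (pE r) => /eqP->.
  exact: imset_f.
have pos : 0 <= size_of w (dval i) p by exact: Re_norm_ge0.
rewrite -(@ler_pXn2r _ 4) ?nnegrE //; apply: le_trans (sel i p q hp hq dis).
rewrite -[4%N]/(2 + 2)%N exprD; apply: ler_wpM2l; first exact: exprn_ge0.
by rewrite ler_pXn2r ?nnegrE ?qmax // Re_norm_ge0.
Qed.

Lemma pattern_term_le (w : Omega) d p : size_of w d p <= #|typed d p.1|%:R.
Proof.
rewrite /size_of /pattern_term /csum; apply: le_trans (Re_norm_sum _ _ _) _.
rewrite -sum1_card natr_sum; apply: ler_sum => x _.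
by rewrite (rphase_norm z_prim).
Qed.

Lemma sum_typed (d : int) (P : pred {ffun 'I_4 -> 'I_K}) :
  (\sum_(beta | P beta) #|typed d beta|)%N = #|[set x in in_range d | P (blocks d x)]|.
Proof.
rewrite -sum1_card (partition_big (blocks d) P) /=; last by move=> x; rewrite inE => /andP[].
apply: eq_bigr => beta Pb; rewrite -sum1_card; apply: eq_bigl => x.
by rewrite !inE -andbA; case: eqP => [->|]; rewrite ?Pb ?andbT ?andbF.
Qed.

Definition steady_gain : R :=
  main_weight * (n%:R ^+ 2 - 24 * n%:R - 4096 * e * n%:R ^+ 2).

Lemma steady_sum (w : Omega) (d : int) :
  \sum_(p : ptype | steady p.1 p.2) Re ((oweight p.2)%:C * pattern_term w d p.1 p.2) <=
  - steady_gain * (\sum_(b : 'I_K) #|typed d [ffun=> b]|)%:R.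
Proof.
pose good o := perm_type o || resonant_type o.
pose F b o := Re ((oweight o)%:C * pattern_term w d [ffun=> b] o).
have cinj : injective (fun b : 'I_K => [ffun=> b] : {ffun 'I_4 -> 'I_K}).
  by move=> b b' /ffunP/(_ ord0); rewrite !ffunE.
have -> : \sum_(p : ptype | steady p.1 p.2)
      Re ((oweight p.2)%:C * pattern_term w d p.1 p.2) =
    \sum_b \sum_(o | good o) F b o.
  rewrite -(pair_big_dep (fun beta => [exists b, beta == [ffun=> b]]) (fun=> good)
    (fun beta o => Re ((oweight o)%:C * pattern_term w d beta o))) /=.
  have -> : \sum_(beta : {ffun 'I_4 -> 'I_K} | [exists b, beta == [ffun=> b]])
       \sum_(o | good o) Re ((oweight o)%:C * pattern_term w d beta o) =
      \sum_(beta in [set ([ffun=> b] : {ffun 'I_4 -> 'I_K}) | b in setT])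
       \sum_(o | good o) Re ((oweight o)%:C * pattern_term w d beta o).
    apply: eq_bigl => beta; apply/existsP/imsetP => [[b /eqP->]|[b _ ->]].
      by exists b.
    by exists b.
  rewrite big_imset /= => [|b b' _ _]; last exact: cinj.
  by apply: eq_bigl => b; rewrite inE.
rewrite natr_sum mulr_sumr; apply: ler_sum => b _.
have -> : \sum_(o | good o) F b o = \sum_(x in typed d [ffun=> b])
    \sum_(o | good o) Re ((oweight o)%:C *
      rphase z w (fun k => cf d [ffun=> b] o k (val x)%:Z)).
  rewrite exchange_big /=; apply: eq_bigr => o _.
  by rewrite /F /pattern_term /csum mulr_sumr Re_sum.
rewrite -sum1_card natr_sum mulr_sumr; apply: ler_sum => x _.
by rewrite mulr1 /steady_gain -mulNr; exact: main_pointwise.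
Qed.

Lemma trivial_sum (w : Omega) (d : int) :
  \sum_(p : ptype | p.2 == [ffun=> None])
    Re ((oweight p.2)%:C * pattern_term w d p.1 p.2) = #|in_range d|%:R.
Proof.
have -> : \sum_(p : ptype | p.2 == [ffun=> None])
    Re ((oweight p.2)%:C * pattern_term w d p.1 p.2) =
    \sum_beta #|typed d beta|%:R.
  rewrite -(pair_big_dep predT (fun _ o => o == [ffun=> None])
    (fun beta o => Re ((oweight o)%:C * pattern_term w d beta o))) /=.
  apply: eq_bigr => beta _; rewrite big_pred1_eq Re_mulC.
  rewrite /oweight big1 ?mul1r => [|r _]; last by rewrite ffunE.
  rewrite /pattern_term /csum (eq_bigr (fun=> 1)) => [|x _].
    by rewrite sumr_const Re_nat.
  by apply: rphase0 => k; rewrite /cf /coef big1 // => r _; rewrite ffunE mul0r.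
rewrite -natr_sum sum_typed; congr (_%:R); apply: eq_card => x.
by rewrite inE andbT.
Qed.

(** The three summands come from the constant term, the steady terms and the shaking terms. The
    latter are at most [B] away from the exceptional blocks, and otherwise are bounded by the number
    of patterns touching one of these at most four blocks. *)
Lemma pattern_bound (w : Omega) (B : R) (i : 'I_(2 * N)) : (0 < L)%N ->
  0 <= B -> selected w B -> dval i != 0 ->
  Re (\sum_(x in in_range (dval i)) \prod_(r < 4) dens w (x%:Z + dval i * pt r)) <=
  #|in_range (dval i)|%:R
  - steady_gain * (\sum_(b : 'I_K) #|typed (dval i) [ffun=> b]|)%:R
  + ((1 + total_weight) ^+ 4 - 1) *
    ((4 * (L + reach (dval i)))%:R + #|{: {ffun 'I_4 -> 'I_K}}|%:R * B).
Proof.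
move=> L0 B0 sel d0; set d := dval i in d0 *.
have [E E4 hE] := exceptional_blocks i B0 sel.
rewrite pattern_expansion pair_big /= Re_sum.
rewrite (bigID (fun p : ptype => p.2 == [ffun=> None])) /=.
rewrite [X in _ + X](bigID (fun p : ptype => steady p.1 p.2)) /= addrA; apply: lerD.
  apply: lerD; first by rewrite le_eqVlt; apply/orP; left; apply/eqP; exact: trivial_sum.
  rewrite -mulNr; apply: le_trans (steady_sum w d).
  rewrite le_eqVlt; apply/orP; left; apply/eqP; apply: eq_bigl => p.
  rewrite andbC andb_idr // => /andP[_ st]; apply/eqP => p0.
  move: st; rewrite p0 => /orP[/imsetP[t _]|/andP[/imsetP[t _]]] /ffunP/(_ ord0);
    by rewrite !ffunE.
pose touch (beta : {ffun 'I_4 -> 'I_K}) := [exists r, beta r \in E].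
pose c beta : R := (if touch beta then #|typed d beta|%:R else 0) + B.
have c0 beta : 0 <= c beta by rewrite addr_ge0 //; case: ifP.
apply: (@le_trans _ _ (\sum_(p : ptype | p.2 != [ffun=> None]) `|oweight p.2| * c p.1)).
  rewrite [leLHS]big_mkcond [leRHS]big_mkcond /=; apply: ler_sum => p _.
  case: (boolP (p.2 == _)) => //= pN.
  case: (boolP (steady _ _)) => [_|nst] /=; first by rewrite mulr_ge0.
  rewrite Re_mulC.
  have [w0|w0] := eqVneq (oweight p.2) 0; first by rewrite w0 normr0 !mul0r.
  have := steady_or_shaking p.1 d0 pN w0; rewrite (negPf nst) /= => sh.
  rewrite -Re_mulC; apply: le_trans (Re_le_norm _) _.
  rewrite Re_normM Re_norm_realC; apply: ler_wpM2l => //.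
  rewrite /c; case: ifPn => [_|/existsPn nt].
    by apply: ler_wpDr => //; exact: pattern_term_le.
  by rewrite add0r; apply: hE.
rewrite -(pair_big predT (fun o => o != [ffun=> None])
   (fun beta o => `|oweight o| * c beta)) /= exchange_big /=.
under eq_bigr => o _ do rewrite -mulr_sumr.
rewrite -mulr_suml sum_oweight; apply: ler_wpM2l.
  by rewrite -sum_oweight sumr_ge0.
rewrite big_split /=; apply: lerD; last by rewrite sumr_const mulr_natl.
rewrite -big_mkcond -natr_sum ler_nat sum_typed.
apply: leq_trans (leq_mul E4 (leqnn _)).
exact: touching_card.
Qed.

(** * Range and mean of the density *)

Lemma chi_norm (w : Omega) b f p : `|chi w b f p| = 1.
Proof. exact: rphase_norm. Qed.

Lemma dens_near1 (w : Omega) (p : int) : `|Re (dens w p) - 1| <= total_weight.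
Proof.
have -> : Re (dens w p) - 1 =
    Re (\sum_(f : opt | f != None) (weight f)%:C * chi w (block p) f p).
  rewrite /dens (bigD1 None) //= ReD Re_mulC mul1r.
  rewrite [chi _ _ None _]rphase0 => [|k]; last by rewrite mul0r.
  have -> : Re (1 : C) = 1 by [].
  by rewrite addrAC subrr add0r.
apply: (@le_trans _ _ (Re `|\sum_(f : opt | f != None)
    (weight f)%:C * chi w (block p) f p|)).
  by have /Re_le := normc_ge_Re (\sum_(f : opt | f != None)
    (weight f)%:C * chi w (block p) f p).
apply: le_trans (Re_norm_sum _ _ _) _; apply: ler_sum => f _.
by rewrite Re_normM Re_norm_realC chi_norm mulr1.
Qed.

(** With difference 0 and one nontrivial factor a pattern sum is the sum of one character over a
    block, so the estimate selected for the difference 0 controls the mean. *)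
Definition single (f : opt) : {ffun 'I_4 -> opt} :=
  [ffun r : 'I_4 => if r == ord0 then f else None].

Lemma sum_single (T : nmodType) (F : 'I_4 -> T) :
  (forall r, r != ord0 -> F r = 0) -> \sum_(r < 4) F r = F ord0.
Proof. by move=> F0; rewrite (bigD1 ord0) //= big1 ?addr0. Qed.

Lemma single_shaking (b : 'I_K) (f : opt) : f != None -> weight f != 0 ->
  shaking 0 [ffun=> b] (single f).
Proof.
case: f => [[[i i'] j]|] //= _; case: ifP => [ii' _|]; last by rewrite eqxx.
have ii'b : ((b, i') == (b, i)) = false.
  by rewrite xpair_eqE eqxx /= eq_sym (negPf ii').
have edgeE (r : 'I_4) : r != ord0 -> lift_edge ([ffun=> b] r) (single (Some (i, i', j)) r) = None.
  by move=> r0; rewrite !ffunE (negPf r0).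
have edge0 : lift_edge (([ffun=> b] : {ffun 'I_4 -> 'I_K}) ord0)
    (single (Some (i, i', j)) ord0) = Some ((b, i), (b, i'), j).
  by rewrite !ffunE.
(* A linear parameter moves: colours 0, 1, 2 have nonzero coefficients in [rel012], and colour 3 has
   one in [rel013]. *)
have [t t0 nz] : exists2 t : 'I_3, val t != 0%N &
    nth 0 [:: 0; rel012 0 k1 k2 j; rel013 0 k1 k3 j] t != 0.
  have pos : (k1 != 0) && (k2 - 0 != 0) && (k1 - k2 != 0) by move: k01 k12 k23; lia.
  case/andP: pos => /andP[p1 p2] p3.
  case: j {edgeE edge0} => [[|[|[|[|//]]]] ?];
    [exists (@Ordinal 3 1 isT)|exists (@Ordinal 3 1 isT)|exists (@Ordinal 3 1 isT)
    |exists (@Ordinal 3 2 isT)]; by rewrite //= /rel012 /rel013 //= ?sub0r ?oppr_eq0.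
apply/existsP; exists ((b, i), t); rewrite /moving /= t0 andbT /slope.
have sumE (F : 'I_4 -> int) : \sum_(r < 4) inc (lift_edge
    (([ffun=> b] : {ffun 'I_4 -> 'I_K}) r) (single (Some (i, i', j)) r)) (b, i) * F r = F ord0.
  rewrite sum_single => [|r r0]; last by rewrite edgeE ?mul0r.
  by rewrite edge0 /= eqxx ii'b subr0 mul1r.
rewrite !sumE edge0 /=.
by case: t t0 nz => [[|[|[|//]]] ?].
Qed.

Lemma single_term (w : Omega) (b : 'I_K) (f : opt) :
  pattern_term w 0 [ffun=> b] (single f) =
  \sum_(x : 'I_N | block x%:Z == b) chi w b f x%:Z.
Proof.
rewrite /pattern_term /csum; apply: eq_big => [x|x _].
  rewrite !inE; have -> : [forall r : 'I_4, 0 <= x%:Z + 0 * pt r < N%:Z].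
    by apply/forallP => r; rewrite mul0r addr0 ltz_nat ltn_ord.
  apply/eqP/eqP => [/ffunP/(_ ord0)|bx]; first by rewrite !ffunE mul0r addr0.
  by apply/ffunP => r; rewrite !ffunE mul0r addr0.
rewrite /chi /rphase; congr (z ^ _); apply: eq_bigr => k _; congr (_ * _).
rewrite /cf /coef sum_single => [|r r0]; last by rewrite !ffunE (negPf r0) mul0r.
by rewrite !ffunE eqxx mul0r addr0.
Qed.

Lemma mean_bound (w : Omega) (B : R) : 0 <= B ->
  (forall p : ptype, shaking 0 p.1 p.2 -> size_of w 0 p <= B) ->
  N%:R - total_weight * (K%:R * B) <= \sum_(x < N) Re (dens w x%:Z).
Proof.
move=> B0 hB.
have -> : \sum_(x < N) Re (dens w x%:Z) = N%:R +
    \sum_(f : opt | f != None) \sum_(b : 'I_K)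
      Re ((weight f)%:C * pattern_term w 0 [ffun=> b] (single f)).
  transitivity (\sum_(f : opt) \sum_(x < N) Re ((weight f)%:C * chi w (block x%:Z) f x%:Z)).
    by rewrite exchange_big /=; apply: eq_bigr => x _; rewrite -Re_sum.
  rewrite (bigD1 None) //=; congr (_ + _).
    rewrite (eq_bigr (fun=> 1)) => [|x _]; first by rewrite sumr_const card_ord.
    rewrite Re_mulC mul1r [chi _ _ None _]rphase0 // => k.
    by rewrite mul0r.
  apply: eq_bigr => f _; rewrite -Re_sum -mulr_sumr Re_mulC.
  rewrite (partition_big (fun x : 'I_N => block x%:Z) predT) //= Re_sum mulr_sumr.
  apply: eq_bigr => b _; rewrite Re_mulC single_term; congr (_ * _); congr Re.
  by apply: eq_bigr => x /eqP->.
rewrite lerD2l /total_weight mulr_suml -sumrN; apply: ler_sum => f fN.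
have -> : - (`|weight f| * (K%:R * B)) = \sum_(b : 'I_K) - (`|weight f| * B).
  by rewrite sumr_const card_ord -[RHS]mulr_natr mulNr; congr (- _); ring.
apply: ler_sum => b _; rewrite lerNl.
have [w0|w0] := eqVneq (weight f) 0; first by rewrite w0 normr0 Re_mulC !mul0r oppr0.
have := hB ([ffun=> b], single f) (single_shaking b fN w0).
rewrite /size_of /= => hX.
have -> : - Re ((weight f)%:C * pattern_term w 0 [ffun=> b] (single f)) =
    Re ((- weight f)%:C * pattern_term w 0 [ffun=> b] (single f)).
  by rewrite !Re_mulC mulNr.
apply: le_trans (Re_le_norm _) _.
by rewrite Re_normM Re_norm_realC normrN ler_wpM2l.
Qed.

End Construction.


(** * Choice of the parameters *)

Lemma total_weight_le (R : rcfType) (n : nat) (eta : R) (a : nat -> R) :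
  (0 < n)%N -> 0 < eta -> (forall j, 0 < a j <= 1) ->
  0 <= total_weight n eta a <= 5 * n%:R ^+ 2 * eta.
Proof.
move=> n0 eta0 a01; rewrite sumr_ge0 //=.
apply: le_trans (@sum_le_card _ _ _ _ eta (ltW eta0) _) _.
  move=> [[[i i'] j]|] //= _; case: ifP => _; last by rewrite normr0 ltW.
  have /andP[a0 a1] := a01 j.
  rewrite normrM (gtr0_norm eta0); apply: ler_piMr; first exact: ltW.
  by case: ifP; rewrite ?normrN gtr0_norm.
rewrite ler_wpM2r ?(ltW eta0) // card_option !card_prod !card_ord.
by rewrite -natrX -natrM ler_nat; nia.
Qed.

Lemma large_modulus (k1 k2 k3 : int) (n K' L : nat) : exists2 M : nat,
  (0 < M)%N & forall (i : 'I_(2 * (K'.+1 * L)))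
    (p : {ffun 'I_4 -> 'I_K'.+1} * {ffun 'I_4 -> option ('I_n * 'I_n * 'I_4)})
    (k : 'I_K'.+1 * 'I_n * 'I_3),
    `|slope 0 k1 k2 k3 (dval i) (fun r => lift_edge (p.1 r) (p.2 r)) k.2 k.1| *
      (K'.+1 * L)%:Z < M%:Z.
Proof.
pose T := ('I_(2 * (K'.+1 * L)) *
  ({ffun 'I_4 -> 'I_K'.+1} * {ffun 'I_4 -> option ('I_n * 'I_n * 'I_4)}) *
  ('I_K'.+1 * 'I_n * 'I_3))%type.
pose F (t : T) := (`|slope 0 k1 k2 k3 (dval t.1.1)
  (fun r => lift_edge (t.1.2.1 r) (t.1.2.2 r)) t.2.2 t.2.1| * (K'.+1 * L))%N.
exists (\sum_t F t).+1 => // i p k.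
rewrite -abszE -PoszM ltz_nat ltnS (bigD1 ((i, p), k)) //=.
exact: leq_addr.
Qed.

Lemma dval_onto (K' L : nat) (d : int) : `|d| < (K'.+1 * L)%:Z ->
  exists i : 'I_(2 * (K'.+1 * L)), dval i = d.
Proof.
move=> dN; have [lt eq] : (absz (d + (K'.+1 * L)%:Z)%R < 2 * (K'.+1 * L))%N /\
    (absz (d + (K'.+1 * L)%:Z))%:Z - (K'.+1 * L)%:Z = d.
  by move: (K'.+1 * L)%N dN => N dN; split; lia.
by exists (Ordinal lt).
Qed.

(** [D] is the length of the pattern. The end of the interval loses [D] patterns and the steady
    terms gain at least the positive part of [L - D], together [max (L, D)]. Subtracting the error
    [(L + D) / 4] leaves at least [L / 2], whatever [D] is. *)
Lemma final_numerics (R : realFieldType) (K L D s : nat) (W g B S : R) :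
  0 <= W -> W <= 1 / 240 -> 1 <= g * K%:R -> (K * (L - D) <= s)%N -> 0 <= g ->
  0 <= B -> (D <= K * L)%N ->
  S <= (K * L - D)%:R - g * s%:R + ((1 + W) ^+ 4 - 1) * ((4 * (L + D))%:R + B) ->
  S <= (K * L)%:R - L%:R / 2 + B.
Proof.
move=> W0 W1 gK sK g0 B0 DN hS.
have Q0 : 0 <= (1 + W) ^+ 4 - 1.
  by rewrite subr_ge0 exprn_ege1 // lerDl.
have Q1 : (1 + W) ^+ 4 - 1 <= 1 / 16.
  have W2 : W ^+ 2 <= W by rewrite expr2; nra.
  have W3 : W ^+ 3 <= W by rewrite exprS; nra.
  have W4 : W ^+ 4 <= W by rewrite exprS; nra.
  have -> : (1 + W) ^+ 4 - 1 = 4 * W + 6 * W ^+ 2 + 4 * W ^+ 3 + W ^+ 4 by ring.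
  lra.
apply: (le_trans hS).
have gs : (L%:R - D%:R : R) <= g * s%:R /\ 0 <= g * s%:R.
  split; last by rewrite mulr_ge0.
  have h1 : (K * (L - D))%:R * g <= s%:R * g by rewrite ler_wpM2r // ler_nat.
  have h2 : (L - D)%:R <= (g * K%:R) * (L - D)%:R :> R by rewrite ler_peMl.
  have h3 : L%:R - D%:R <= (L - D)%:R :> R.
    by rewrite lerBlDr -natrD ler_nat addnC -leq_subLR.
  rewrite natrM in h1.
  by apply: (le_trans h3); apply: (le_trans h2); rewrite (mulrC g s%:R); move: h1; rewrite mulrAC (mulrC K%:R) => ->.
case: gs => gs gs0.
rewrite natrB // (natrM _ 4) (natrD _ L).
set Q := (1 + W) ^+ 4 - 1 in Q0 Q1 *; set x := g * s%:R in gs gs0 *.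
have [L0 D0] : 0 <= L%:R :> R /\ 0 <= D%:R :> R by [].
set l := L%:R in gs L0 *; set dd := D%:R in gs D0 *.
have e1 : Q * (4%:R * (l + dd) + B) <= (1 / 16) * (4%:R * (l + dd) + B).
  by apply: ler_wpM2r => //; lra.
by move: e1; set y := Q * _; move=> e1; lra.
Qed.

(** The saving is half a block out of [K'.+1]. The number of blocks is fixed before the pattern,
    which makes the final constant absolute. *)
Lemma quadratic_density (R : realType) : exists K' : nat,
  forall k1 k2 k3 : int, 0 < k1 -> k1 < k2 -> k2 < k3 -> 0 + k3 != k1 + k2 ->
  forall delta : R, 0 < delta -> exists L0 : nat, forall L : nat, (L0 <= L)%N ->
  exists f : int -> R,
  [/\ forall p, 0 <= f p <= 2,
      (1 - delta) * (K'.+1 * L)%:R <= \sum_(x < K'.+1 * L) f x%:Z &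
      forall d : int, d != 0 -> `|d| < (K'.+1 * L)%:Z ->
        \sum_(x in in_range k1 k2 k3 K' L d)
           \prod_(r < 4) f (x%:Z + d * pattern_pt 0 k1 k2 k3 r) <=
        (1 - (2 * K'.+1%:R)^-1 + delta) * (K'.+1 * L)%:R].
Proof.
(* With these values [24 * n = n ^ 2 / 2] and [4096 * e = 1 / 4], so a quarter of [n ^ 2] times the
   main weight remains as gain; [eta] brings the total weight below [1 / 240]. Then [m0] bounds the
   gain from below, and [K] is taken larger than its inverse. *)
pose n := 48%N; pose e : R := (2 ^+ 14)^-1; pose eta : R := (1200 * n%:R ^+ 2)^-1.
have n0 : 0 < n%:R :> R by rewrite ltr0n.
have e0 : 0 < e by rewrite invr_gt0 exprn_gt0.
have e1 : e <= 1 by rewrite invf_le1 ?exprn_gt0 // exprn_ege1 // ler1n.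
have eta0 : 0 < eta by rewrite invr_gt0 mulr_gt0 ?exprn_gt0.
pose m0 := eta ^+ 4 * e ^+ 3.
have m00 : 0 < m0 by rewrite mulr_gt0 ?exprn_gt0.
pose K' := Num.bound m0^-1; pose K := K'.+1.
have K0 : 0 < K%:R :> R by rewrite ltr0n.
have mK : 1 <= m0 * K%:R.
  rewrite mulrC -ler_pdivrMr // mul1r ltW //.
  apply: lt_trans (archi_boundP _) _; first by rewrite invr_ge0 ltW.
  by rewrite ltr_nat.
exists K' => k1 k2 k3 k01 k12 k23 np delta delta0.
have [a a_ok] : exists a, amplitude_ok e (colour_resonance 0 k1 k2 k3) a.
  have [h1 h2 h3] : [/\ ~~ (resonant (k1 - 0) (k2 - k1) (k3 - k2) 0 1 && resonant (k1 - 0) (k2 - k1) (k3 - k2) 2 3),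
      ~~ (resonant (k1 - 0) (k2 - k1) (k3 - k2) 0 2 && resonant (k1 - 0) (k2 - k1) (k3 - k2) 1 3) &
      ~~ (resonant (k1 - 0) (k2 - k1) (k3 - k2) 0 3 && resonant (k1 - 0) (k2 - k1) (k3 - k2) 1 2)].
    by apply: complementary_not_resonant; rewrite ?subr_gt0 //; lia.
  apply: amplitudes_exist => //; first by rewrite e0.
  by move=> u v; exact: resonant_sym.
have [a01 aprod _] := a_ok.
have /andP[W0 W1] : 0 <= total_weight n eta a <= 1 / 240.
  have /andP[-> /le_trans] := total_weight_le (n := n) isT eta0 a01; apply.
  by rewrite /eta; rewrite le_eqVlt; apply/orP; left; apply/eqP; field; rewrite gt_eqF.
have gain : m0 <= steady_gain n eta a e.
  rewrite /steady_gain /main_weight /m0 -[leLHS]mulr1; apply: ler_pM => //.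
  - by rewrite mulr_ge0 ?exprn_ge0 ?(ltW eta0) ?(ltW e0).
  - by rewrite ler_pM2l ?exprn_gt0.
  - have -> : 4096 * e = 1 / 4 :> R by rewrite /e; field.
    by rewrite /n; lra.
pose sc : R := selection_const R n K'.
have sc0 : 0 <= sc by rewrite addr_ge0 ?mulr_ge0 ?exprn_ge0.
(* With [B = q * N] the [K ^ 4] block types cost [delta * N] in total, and for large [L] the
   selected bounds [sc * N ^ 3] and [sc * N] are at most [B ^ 4] and [B ^ 2]. *)
pose q : R := delta / K%:R ^+ 4.
have q0 : 0 < q by rewrite divr_gt0 ?exprn_gt0.
pose L0 := (Num.bound (sc / q ^+ 4) + Num.bound (sc / q ^+ 2)).+1.
exists L0 => L LL0.
have L_gt0 : (0 < L)%N by exact: leq_trans LL0.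
have N_gt0 : (0 < K * L)%N by rewrite muln_gt0.
have N0 : 0 < (K * L)%:R :> R by rewrite ltr0n.
have big (x : R) : 0 <= x -> (Num.bound x <= L0)%N -> x <= (K * L)%:R.
  move=> x0 xb; apply: ltW; apply: lt_le_trans (archi_boundP x0) _.
  by rewrite ler_nat (leq_trans xb) // (leq_trans LL0) // leq_pmull.
have N4 : sc <= q ^+ 4 * (K * L)%:R.
  rewrite mulrC -ler_pdivrMr ?exprn_gt0 //; apply: big.
    by rewrite divr_ge0 ?exprn_ge0 ?(ltW q0).
  exact: leq_trans (leq_addr _ _) (leqnSn _).
have N2 : sc <= q ^+ 2 * (K * L)%:R.
  rewrite mulrC -ler_pdivrMr ?exprn_gt0 //; apply: big.
    by rewrite divr_ge0 ?exprn_ge0 ?(ltW q0).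
  exact: leq_trans (leq_addl _ _) (leqnSn _).
pose B := q * (K * L)%:R.
have B0 : 0 <= B by rewrite mulr_ge0 ?ltW.
have pow4 (x y : R) : (x * y) ^+ 4 = x ^+ 4 * y * y ^+ 3 by ring.
have pow2 (x y : R) : (x * y) ^+ 2 = x ^+ 2 * y * y by ring.
have [M M0 M_large] := large_modulus k1 k2 k3 n K' L.
have [z z_prim] := closed_prim_root_exists (complex R) M0.
have [w [sel sel0]] := selection z_prim k01 k12 k23 np e0 eta0 M_large N_gt0.
have selB : selected k1 k2 k3 L z w B.
  move=> i p p' h h' dis; apply: le_trans (sel i p p' h h' dis) _.
  rewrite /B pow4 -/K -/sc.
  by apply: ler_wpM2r => //; rewrite exprn_ge0 // ltW.
have sel0B p : shaking k1 k2 k3 0 p.1 p.2 -> size_of k1 k2 k3 L z w 0 p <= B.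
  move=> h; rewrite -(@ler_pXn2r _ 2) ?nnegrE // ?Re_norm_ge0 //.
  apply: le_trans (sel0 p h) _; rewrite /B pow2 -/K -/sc.
  by apply: ler_wpM2r => //; rewrite ltW.
exists (fun p => Re (dens k1 k2 k3 L z eta a w p)); split.
- move=> p; have := dens_near1 k1 k2 k3 L eta a z_prim w p.
  by rewrite ler_norml => /andP[h1 h2]; apply/andP; split; lra.
- apply: le_trans (mean_bound a z_prim k01 k12 k23 np e0 eta0 B0 sel0B).
  rewrite mulrBl mul1r lerD2l lerN2 -/K.
  apply: (@le_trans _ _ (1 * (K%:R * B))).
    by apply: ler_wpM2r; [rewrite mulr_ge0 | lra].
  rewrite mul1r /B mulrA ler_wpM2r // /q mulrCA ler_piMr ?(ltW delta0) //.
  by rewrite ler_pdivrMr ?exprn_gt0 // mul1r exprS ler_peMr ?exprn_ege1 ?ler1n.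
move=> d d0 dN.
have [i di] : exists i : 'I_(2 * (K * L)), dval i = d.
  exact: dval_onto.
have dens_sum : \sum_(x in in_range k1 k2 k3 K' L d)
     \prod_(r < 4) Re (dens k1 k2 k3 L z eta a w (x%:Z + d * pattern_pt 0 k1 k2 k3 r)) =
   Re (\sum_(x in in_range k1 k2 k3 K' L d)
     \prod_(r < 4) dens k1 k2 k3 L z eta a w (x%:Z + d * pattern_pt 0 k1 k2 k3 r)).
  rewrite Re_sum; apply: eq_bigr => x _.
  rewrite -[LHS]/(Re (real_complex R _)) rmorph_prod; congr Re.
  by apply: eq_bigr => r _; apply: RRe_real; exact: dens_real.
have KL2 : (K * L)%:R - L%:R / 2 = (1 - (2 * K%:R)^-1) * (K * L)%:R :> R.
  by rewrite natrM; field; rewrite gt_eqF.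
have KB : K%:R ^+ 4 * B = delta * (K * L)%:R.
  by rewrite /B /q; field; rewrite gt_eqF.
rewrite dens_sum mulrDl -KL2 -KB.
have K4 : #|{: {ffun 'I_4 -> 'I_K}}|%:R = K%:R ^+ 4 :> R.
  by rewrite card_ffun !card_ord natrX.
have [DN|ND] := leqP (reach k3 d) (K * L); last first.
  have -> : in_range k1 k2 k3 K' L d = finset.set0.
    apply/eqP; rewrite -cards_eq0 -leqn0.
    by apply: leq_trans (in_range_card _ _ z_prim k01 k12 k23 np e0 eta0 d) _;
      rewrite leqn0 subn_eq0 ltnW.
  rewrite big_set0 /=; apply: addr_ge0; last by rewrite mulr_ge0 ?exprn_ge0.
  rewrite KL2 mulr_ge0 // subr_ge0 invf_le1 ?mulr_gt0 //.
  by have : 1 <= K%:R :> R by [rewrite ler1n]; lra.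
have := pattern_bound z_prim k01 k12 k23 np e0 eta0 a_ok L_gt0 B0 selB (i := i).
rewrite di => /(_ d0) pb.
apply: (@final_numerics _ K L (reach k3 d) (\sum_(b < K) #|typed k1 k2 k3 L d [ffun=> b]|)
  (total_weight n eta a) (steady_gain n eta a e)) => //.
- by apply: (le_trans mK); rewrite ler_wpM2r.
- rewrite -[X in (X * _ <= _)%N]card_ord -sum_nat_const; apply: leq_sum => b _.
  exact: (typed_const_card z_prim k01 k12 k23 np e0 eta0).
- exact: le_trans (ltW m00) gain.
- by rewrite mulr_ge0 ?exprn_ge0.
apply: (le_trans pb); rewrite -K4; apply: lerD => //; rewrite lerD2r ler_nat.
exact: (in_range_card _ _ z_prim k01 k12 k23 np e0 eta0).
Qed.

(** * Random sets of prescribed density *)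

Section Sampling.
Variables (R : realType) (T : finType) (f : T -> R).
Hypothesis f01 : forall y, 0 <= f y <= 1.

(** The probability of [A] when each [y] is chosen independently with probability [f y]. *)
Definition sample_law (A : {set T}) : R :=
  \prod_y (if y \in A then f y else 1 - f y).

Lemma sample_law_ge0 (A : {set T}) : 0 <= sample_law A.
Proof.
apply: prodr_ge0 => y _; have /andP[h0 h1] := f01 y.
by case: ifP; rewrite ?subr_ge0.
Qed.

Lemma sum_sample_law_prod (u v : T -> R) :
  \sum_(A : {set T}) sample_law A * \prod_y (if y \in A then u y else v y) =
  \prod_y (f y * u y + (1 - f y) * v y).
Proof.
rewrite bigA_distr; apply: eq_bigr => A _; rewrite /sample_law -big_split /=.
by apply: eq_bigr => y _; case: ifP.
Qed.

Lemma sum_sample_law : \sum_(A : {set T}) sample_law A = 1.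
Proof.
transitivity (\sum_(A : {set T}) sample_law A * \prod_y (if y \in A then 1 else 1 : R)).
  by apply: eq_bigr => A _; rewrite big1 ?mulr1 // => y _; case: ifP.
by rewrite sum_sample_law_prod big1 // => y _; ring.
Qed.

Lemma sample_contains (C : {set T}) :
  \sum_(A : {set T}) sample_law A * (C \subset A)%:R = \prod_(y in C) f y.
Proof.
transitivity (\sum_(A : {set T}) sample_law A *
    \prod_y (if y \in A then 1 else (y \notin C)%:R)).
  apply: eq_bigr => A _; congr (_ * _).
  case: (boolP (C \subset A)) => [/subsetP CA|/subsetPn[y yC yA]].
    rewrite big1 // => y _; case: ifPn => // yA.
    by rewrite (contraNN (CA y) yA).
  by rewrite (bigD1 y) //= (negPf yA) yC mul0r.
rewrite sum_sample_law_prod [RHS]big_mkcond; apply: eq_bigr => y _.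
by case: (y \in C); rewrite /= ?mulr1 ?mulr0 ?addr0 //; ring.
Qed.

Lemma expand_one_plus (U : finType) (F : U -> R) :
  \prod_u (1 + F u) = \sum_(B : {set U}) \prod_(u in B) F u.
Proof.
transitivity (\prod_u (F u + 1)); first by apply: eq_bigr => u _; rewrite addrC.
by rewrite bigA_distr; apply: eq_bigr => B _; rewrite [RHS]big_mkcond.
Qed.

(** Disjointness makes the events [S u \subset A] independent. Both sides are expanded over subsets
    [B], and [sample_contains] is applied to the union of the [S u] with [u] in [B]. *)
Lemma sample_mgf (U : finType) (Y : {set U}) (S : U -> {set T}) (rho : R) :
  {in Y &, forall u u', u != u' -> [disjoint S u & S u']} ->
  \sum_(A : {set T}) sample_law A * (1 + rho) ^+ #|[set u in Y | S u \subset A]| =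
  \prod_(u in Y) (1 + rho * \prod_(y in S u) f y).
Proof.
move=> dis; pose F (A : {set T}) u := if u \in Y then rho * (S u \subset A)%:R else 0.
transitivity (\sum_(A : {set T}) sample_law A * \prod_u (1 + F A u)).
  apply: eq_bigr => A _; congr (_ * _); rewrite -prodr_const [LHS]big_mkcond.
  apply: eq_bigr => u _; rewrite /F !inE; case: (u \in Y) => /=; last by rewrite addr0.
  by case: (S u \subset A); rewrite ?mulr1 ?mulr0 ?addr0.
pose G u := if u \in Y then rho * \prod_(y in S u) f y else 0.
have -> : \prod_(u in Y) (1 + rho * \prod_(y in S u) f y) = \prod_u (1 + G u).
  by rewrite big_mkcond; apply: eq_bigr => u _; rewrite /G; case: ifP; rewrite ?addr0.
rewrite expand_one_plus.
under eq_bigr => A _ do rewrite expand_one_plus mulr_sumr.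
rewrite exchange_big /=; apply: eq_bigr => B _.
case: (boolP (B \subset Y)) => [/subsetP BY|/subsetPn[u uB uY]]; last first.
  rewrite big1 => [|A _]; first by rewrite (bigD1 u) //= /G (negPf uY) mul0r.
  by rewrite (bigD1 u) //= /F (negPf uY) mul0r mulr0.
pose S' u := if u \in B then S u else set0.
have dis' u u' : u != u' -> [disjoint S' u & S' u'].
  move=> uu'; rewrite /S' -setI_eq0; case: ifP => [uB|_]; last by rewrite set0I.
  case: ifP => [u'B|_]; last by rewrite setI0.
  by rewrite setI_eq0; apply: dis => //; exact: BY.
have FE A : \prod_(u in B) F A u = rho ^+ #|B| * ((\bigcup_u S' u) \subset A)%:R.
  transitivity (\prod_(u in B) (rho * (S u \subset A)%:R)).
    by apply: eq_bigr => u uB; rewrite /F (BY u uB).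
  rewrite big_split /= prodr_const; congr (_ * _).
  case: (boolP (_ \subset A)) => [/bigcupsP h|].
    by rewrite big1 // => u uB; have := h u isT; rewrite /S' uB => ->.
  move=> nsub; have [u uB nS] : exists2 u, u \in B & ~~ (S u \subset A).
    apply/exists_inP; apply: contraNT nsub => /exists_inPn h.
    apply/bigcupsP => u _; rewrite /S'; case: ifP => [uB|_]; last exact: sub0set.
    by have := h u uB; rewrite negbK.
  by rewrite (bigD1 u) //= (negPf nS) mul0r.
under eq_bigr => A _ do rewrite FE mulrCA.
rewrite -mulr_sumr sample_contains (partition_disjoint_bigcup _ _ dis').
transitivity (\prod_(u in B) (rho * \prod_(y in S u) f y)); last first.
  by apply: eq_bigr => u uB; rewrite /G (BY u uB).
rewrite big_split /= prodr_const; congr (_ * _); rewrite [RHS]big_mkcond /=.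
by apply: eq_bigr => u _; rewrite /S'; case: ifP => // _; rewrite big_set0.
Qed.

Lemma sample_exists (Phi : {set T} -> R) (D : R) :
  \sum_(A : {set T}) sample_law A * Phi A <= D -> exists A, Phi A <= D.
Proof.
move=> le_D; apply/existsP; apply: contraT => /existsPn gt_D; exfalso.
have z : \sum_(A : {set T}) sample_law A * (Phi A - D) = 0.
  apply/eqP; rewrite eq_le; apply/andP; split; last first.
    apply: sumr_ge0 => A _; rewrite mulr_ge0 ?sample_law_ge0 // subr_ge0 ltW //.
    by rewrite ltNge gt_D.
  under eq_bigr => A _ do rewrite mulrBr.
  by rewrite sumrB -mulr_suml sum_sample_law mul1r subr_le0.
have := sum_sample_law; rewrite big1 => [/eqP|A _]; first by rewrite eq_sym oner_eq0.
have pos A' : true -> 0 <= sample_law A' * (Phi A' - D).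
  move=> _; rewrite mulr_ge0 ?sample_law_ge0 // subr_ge0 ltW //.
  by rewrite ltNge gt_D.
have /eqP := psumr_eq0P pos z (i := A) isT.
rewrite mulf_eq0 subr_eq0 => /orP[/eqP//|/eqP e].
by have := gt_D A; rewrite e lexx.
Qed.

Variables (I : finType) (c : nat) (X : I -> {set T}) (S : I -> T -> {set T}).
Variables (col : I -> T -> 'I_c) (rho : R).
Hypothesis rho_gt0 : 0 < rho.
Hypothesis rho_le : rho <= 1 / 2.
Hypothesis disS : forall i, {in X i &, forall x x', x != x' ->
  col i x = col i x' -> [disjoint S i x & S i x']}.
Hypothesis large : (#|I| * c + 1)%:R <= expR (rho ^+ 2 * #|T|%:R).

Let coloured i k := [set x in X i | col i x == k].
Let hits i k (A : {set T}) := #|[set x in coloured i k | S i x \subset A]|.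
Let expected i k := \sum_(x in coloured i k) \prod_(y in S i x) f y.

Lemma hits_mgf i k :
  \sum_(A : {set T}) sample_law A * (1 + rho) ^+ hits i k A <=
  expR (rho * expected i k).
Proof.
rewrite sample_mgf; last first.
  move=> x x'; rewrite !inE => /andP[xX /eqP xk] /andP[x'X /eqP x'k] xx'.
  by apply: disS => //; rewrite xk x'k.
rewrite /expected mulr_sumr expR_sum; apply: ler_prod => x _.
rewrite expR_ge1Dx andbT addr_ge0 // mulr_ge0 ?(ltW rho_gt0) //.
by apply: prodr_ge0 => y _; case/andP: (f01 y).
Qed.

Lemma size_mgf :
  \sum_(A : {set T}) sample_law A * (1 - rho) ^+ #|A| <=
  expR (- (rho * \sum_y f y)).
Proof.
have -> : \sum_(A : {set T}) sample_law A * (1 - rho) ^+ #|A| =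
    \sum_(A : {set T}) sample_law A * \prod_y (if y \in A then 1 - rho else 1).
  by apply: eq_bigr => A _; rewrite -big_mkcond prodr_const.
rewrite sum_sample_law_prod mulr_sumr -sumrN expR_sum; apply: ler_prod => y _; have /andP[y0 y1] := f01 y.
have rho0 := rho_gt0; have rho1 := rho_le.
have -> : f y * (1 - rho) + (1 - f y) * 1 = 1 - rho * f y by ring.
apply/andP; split; first by nra.
exact: expR_ge1Dx.
Qed.

(** Each normalised exponential moment in [Phi] has mean at most 1, so for some [A] all of them are
    at most [expR (rho ^+ 2 * #|T|%:R)]. Patterns of one index may overlap, so independence is only
    used within each of the [c] colours. *)
Lemma sample : exists A : {set T},
  \sum_y f y - 3 * rho * #|T|%:R <= #|A|%:R /\
  forall i, #|[set x in X i | S i x \subset A]|%:R <=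
    \sum_(x in X i) \prod_(y in S i x) f y + c%:R * (2 * rho * #|T|%:R).
Proof.
have rho0 := rho_gt0; have rho1 := rho_le.
pose Phi (A : {set T}) := \sum_(t : I * 'I_c)
    (1 + rho) ^+ hits t.1 t.2 A * expR (- (rho * expected t.1 t.2)) +
  (1 - rho) ^+ #|A| * expR (rho * \sum_y f y).
have [|A PhiA] := @sample_exists Phi (#|I| * c + 1)%:R.
  under eq_bigr => A _ do rewrite mulrDr mulr_sumr.
  rewrite big_split /= exchange_big /= natrD; apply: lerD.
    rewrite -[X in (_ * X)%:R]card_ord -card_prod -sumr_const; apply: ler_sum => t _.
    under eq_bigr => A _ do rewrite mulrA.
    by rewrite -mulr_suml expRN ler_pdivrMr ?expR_gt0 // mul1r hits_mgf.
  under eq_bigr => A _ do rewrite mulrA.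
  rewrite -mulr_suml -[rho * \sum_y f y]opprK expRN ler_pdivrMr ?expR_gt0 //.
  by rewrite mul1r size_mgf.
have {}PhiA : Phi A <= expR (rho ^+ 2 * #|T|%:R) := le_trans PhiA large.
have term_ge0 (t : I * 'I_c) :
    0 <= (1 + rho) ^+ hits t.1 t.2 A * expR (- (rho * expected t.1 t.2)).
  by rewrite mulr_ge0 ?expR_ge0 // exprn_ge0 //; lra.
have size_ge0 : 0 <= (1 - rho) ^+ #|A| * expR (rho * \sum_y f y).
  by rewrite mulr_ge0 ?expR_ge0 // exprn_ge0 //; lra.
have cardT (B : {set T}) : #|B|%:R <= #|T|%:R :> R by rewrite ler_nat max_card.
exists A; split.
  have hA : (1 - rho) ^+ #|A| * expR (rho * \sum_y f y) <= expR (rho ^+ 2 * #|T|%:R).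
    apply: le_trans PhiA; rewrite /Phi lerDr; exact: sumr_ge0.
  (* A lower bound for the logarithm of [1 - rho]; the deficit in size is then at most
     [rho * #|T| + 2 * rho * #|A|]. *)
  have low : expR (- (rho + 2 * rho ^+ 2)) <= 1 - rho.
    rewrite expRN invf_ple ?posrE ?expR_gt0 //; last by lra.
    apply: le_trans (expR_ge1Dx _).
    rewrite -[leLHS]mul1r ler_pdivrMr; last by lra.
    have : 0 <= rho * rho * (1 - 2 * rho) by rewrite !mulr_ge0 ?(ltW rho0) //; lra.
    by rewrite expr2; lra.
  have {}low : expR (- (rho + 2 * rho ^+ 2) * #|A|%:R) <= (1 - rho) ^+ #|A|.
    by rewrite expRM_natr lerXn2r // ?nnegrE ?expR_ge0 //; lra.
  have : expR (- (rho + 2 * rho ^+ 2) * #|A|%:R + rho * \sum_y f y) <=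
      expR (rho ^+ 2 * #|T|%:R).
    by apply: le_trans hA; rewrite expRD ler_pM2r ?expR_gt0.
  rewrite ler_expR; have := cardT A; have : 0 <= #|A|%:R :> R by [].
  move: (#|A|%:R) (#|T|%:R) (\sum_y f y) => m N s m0 mN h.
  rewrite -(ler_pM2l rho0); move: h; rewrite expr2 => h.
  have : rho * m * rho <= rho * N * rho by rewrite !ler_pM2r ?ler_pM2l.
  nra.
move=> i; pose p t := \sum_(x in coloured i t) \prod_(y in S i x) f y.
have hit t : (hits i t A)%:R <= p t + 2 * rho * #|T|%:R.
  have hA : (1 + rho) ^+ hits i t A * expR (- (rho * expected i t)) <=
      expR (rho ^+ 2 * #|T|%:R).
    apply: le_trans PhiA; rewrite /Phi (bigD1 (i, t)) //= -addrA lerDl.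
    by rewrite addr_ge0 // sumr_ge0.
  (* A lower bound for the logarithm of [1 + rho]; the excess is then at most [rho * #|T|] plus
     [rho] times the number of hits. *)
  have low : expR (rho - rho ^+ 2) <= 1 + rho.
    rewrite -[leRHS]invrK -[leLHS]invrK lef_pV2 ?posrE ?invr_gt0 ?expR_gt0 //; last by lra.
    rewrite -expRN; apply: le_trans (expR_ge1Dx _).
    rewrite -[leLHS]mul1r ler_pdivrMr; last by lra.
    have : 0 <= rho * rho * rho by rewrite !mulr_ge0 ?(ltW rho0).
    by rewrite expr2; lra.
  have {}low : expR ((rho - rho ^+ 2) * (hits i t A)%:R) <= (1 + rho) ^+ hits i t A.
    by rewrite expRM_natr lerXn2r // ?nnegrE ?expR_ge0 //; lra.
  have : expR ((rho - rho ^+ 2) * (hits i t A)%:R - rho * expected i t) <=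
      expR (rho ^+ 2 * #|T|%:R).
    by apply: le_trans hA; rewrite expRD ler_pM2r ?expR_gt0.
  rewrite ler_expR /expected -/(p t).
  have := cardT [set x in coloured i t | S i x \subset A]; rewrite -/(hits i t A).
  move: ((hits i t A)%:R) (#|T|%:R) (p t) => m N s mN h.
  rewrite -(ler_pM2l rho0); move: h; rewrite expr2 => h.
  have : rho * m * rho <= rho * N * rho by rewrite !ler_pM2r ?ler_pM2l.
  nra.
have -> : \sum_(x in X i) \prod_(y in S i x) f y = \sum_(t : 'I_c) p t.
  rewrite (partition_big (col i) predT) //=; apply: eq_bigr => t _.
  by apply: eq_bigl => x; rewrite inE.
have -> : #|[set x in X i | S i x \subset A]| = (\sum_(t : 'I_c) hits i t A)%N.
  rewrite -sum1_card (partition_big (col i) predT) //=; apply: eq_bigr => t _.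
  rewrite /hits -sum1_card; apply: eq_bigl => x; rewrite !inE.
  by rewrite andbAC.
rewrite natr_sum -[X in X%:R * _]card_ord mulr_natl -sumr_const -big_split /=.
exact: ler_sum.
Qed.
End Sampling.

(** * Random sets and patterns in an interval *)

Lemma same_residue (q x x' : nat) (t : int) : (0 < q)%N ->
  x%:Z = x'%:Z + q%:Z * t -> (x %/ q)%:Z = (x' %/ q)%:Z + t.
Proof.
move=> q0 e; have nat_case (a b s : nat) : a = (b + s * q)%N -> (a %/ q = b %/ q + s)%N.
  by move=> ->; rewrite addnC divnMDl // addnC.
case: t e => s e.
  by rewrite (nat_case x x' s) ?PoszD //; lia.
by rewrite (nat_case x' x s.+1) ?NegzE ?PoszD; [lia|rewrite NegzE in e; nia].
Qed.

(** Used with [q] the absolute value of the difference: two patterns sharing a point start at a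
    distance [q * t] with [t] at most [k3], so [k3 + 1] colours tell them apart. *)
Lemma colour_collision (q c x x' : nat) (t : int) : (0 < q)%N ->
  x%:Z = x'%:Z + q%:Z * t -> `|t| < c%:Z ->
  (x %/ q = x' %/ q %[mod c])%N -> x = x'.
Proof.
move=> q0 e tc /eqP; have := same_residue q0 e; move: (x %/ q)%N (x' %/ q)%N => u v uv.
move=> cong; suff t0 : t = 0 by move: e; rewrite t0 mulr0 addr0 => -[].
have dv : (c%:Z %| t)%Z.
  have -> : t = u%:Z - v%:Z by rewrite uv; ring.
  by rewrite -eqz_mod_dvd !modz_nat eqz_nat.
apply/eqP; apply: contraTT tc => tn0; rewrite -leNgt.
move: dv; rewrite dvdzE => /dvdn_leq; rewrite absz_gt0 => /(_ tn0).
by rewrite -lez_nat abszE.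
Qed.

Lemma dist_bounded (u v k : int) : 0 <= u <= k -> 0 <= v <= k ->
  `|u - v| < (absz k).+1%:Z.
Proof. lia. Qed.

Section PatternSample.
Variables (R : realType) (k1 k2 k3 : int) (K' L : nat).
Hypotheses (k01 : 0 < k1) (k12 : k1 < k2) (k23 : k2 < k3).
Local Notation N := (K'.+1 * L)%N.
Local Notation pt := (pattern_pt 0 k1 k2 k3).
Local Notation rng := (in_range k1 k2 k3 K' L).

Definition place (d : int) (x : 'I_N) (r : 'I_4) : 'I_N :=
  insubd x (absz (x%:Z + d * pt r)).

Definition occurrences (A : {set 'I_N}) (d : int) : {set 'I_N} :=
  [set x in rng d | [forall r, place d x r \in A]].

Lemma placeE (d : int) (x : 'I_N) (r : 'I_4) : x \in rng d ->
  (place d x r)%:Z = x%:Z + d * pt r.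
Proof.
rewrite inE => /forallP/(_ r) /andP[h0 hN]; rewrite /place val_insubd.
have pos : (absz (x%:Z + d * pt r))%:Z = x%:Z + d * pt r by rewrite gez0_abs.
by rewrite -ltz_nat pos hN pos.
Qed.

Lemma pt_bounds (r : 'I_4) : 0 <= pt r <= k3.
Proof.
by move: k01 k12 k23; case: r => [[|[|[|[|//]]]] ?]; rewrite /pattern_pt /=; lia.
Qed.

Lemma pt_inj (r s : 'I_4) : pt r = pt s -> r = s.
Proof.
move: k01 k12 k23; case: r => [[|[|[|[|//]]]] ?];
by case: s => [[|[|[|[|//]]]] ?]; rewrite /pattern_pt /= => *; apply: val_inj => //=; exfalso; lia.
Qed.

Lemma in_range_far (d : int) : N%:Z <= `|d| -> rng d = set0.
Proof.
move=> dN; apply/setP => x; rewrite !inE; apply/negbTE; apply/negP.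
move=> /forallP/(_ (inord 3)); rewrite /pattern_pt inordK //= => /andP[h0 h1].
have : `|d| <= `|d * k3|.
  by rewrite normrM ler_peMr //; move: k01 k12 k23; lia.
have := ltn_ord x; move: (d * k3) h0 h1 => y h0 h1; lia.
Qed.

Lemma pattern_sample (f : int -> R) (rho : R) :
  (forall p, 0 <= f p <= 1) -> 0 < rho -> rho <= 1 / 2 ->
  (2 * N * `|k3|.+1 + 1)%:R <= expR (rho ^+ 2 * N%:R) ->
  exists A : {set 'I_N},
    \sum_(x < N) f x%:Z - 3 * rho * N%:R <= #|A|%:R /\
    forall d : int, d != 0 -> `|d| < N%:Z -> #|occurrences A d|%:R <=
      \sum_(x in rng d) \prod_(r < 4) f (x%:Z + d * pt r) +
      (`|k3|.+1)%:R * (2 * rho * N%:R).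
Proof.
move=> f01 rho0 rho1 large.
(* The difference 0 is discarded, since the colour is defined through division by the difference. *)
pose X (i : 'I_(2 * N)) := if dval i == 0 then set0 else rng (dval i).
pose S (i : 'I_(2 * N)) (x : 'I_N) := [set place (dval i) x r | r in 'I_4].
pose col (i : 'I_(2 * N)) (x : 'I_N) : 'I_(`|k3|.+1) :=
  inord ((x %/ `|dval i|) %% `|k3|.+1).
have XP i x : x \in X i -> dval i != 0 /\ x \in rng (dval i).
  by rewrite /X; case: ifPn => [_|d0]; rewrite ?inE.
have disS i : {in X i &, forall x x', x != x' -> col i x = col i x' ->
    [disjoint S i x & S i x']}.
  move=> x x' /XP[d0 xr] /XP[_ x'r] xx' /(congr1 val) /=.
  rewrite /= !inordK ?ltn_pmod // => cong.
  rewrite -setI_eq0; apply/eqP/setP => y; rewrite !inE; apply/negbTE.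
  apply: contra xx' => /andP[/imsetP[r _ yr] /imsetP[r' _ yr']].
  have e : x%:Z + dval i * pt r = x'%:Z + dval i * pt r'.
    by rewrite -!placeE // -yr -yr'.
  have rk := pt_bounds r; have r'k := pt_bounds r'.
  apply/eqP/val_inj.
  have [dp|dn] := lerP 0 (dval i).
    apply: (@colour_collision `|dval i| `|k3|.+1 x x' (pt r' - pt r)) => //.
    - by rewrite absz_gt0.
    - by rewrite gez0_abs //; apply: (addIr (dval i * pt r)); rewrite e; ring.
    - exact: dist_bounded.
  apply: (@colour_collision `|dval i| `|k3|.+1 x x' (pt r - pt r')) => //.
  - by rewrite absz_gt0.
  - by rewrite ltz0_abs //; apply: (addIr (dval i * pt r)); rewrite e; ring.
  - exact: dist_bounded.
have [|A [sizeA hitA]] := @sample R _ (fun x : 'I_N => f x%:Z) (fun y => f01 _)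
    _ _ X S col rho rho0 rho1 disS.
  by rewrite !card_ord.
rewrite card_ord in sizeA; setoid_rewrite card_ord in hitA.
exists A; split=> // d d0 dN.
have [i di] := dval_onto dN.
have := hitA i; rewrite /X di (negPf d0) => /le_trans hA.
have -> : \sum_(x in rng d) \prod_(r < 4) f (x%:Z + d * pt r) =
    \sum_(x in rng d) \prod_(y in S i x) f y%:Z.
  apply: eq_bigr => x xr; rewrite /S di big_imset /=.
    by apply: eq_big => [r|r _]; rewrite ?inE // placeE.
  move=> r s _ _ rs; apply: pt_inj; apply: (mulfI d0).
  by apply: (addrI x%:Z); rewrite -!placeE // rs.
apply: le_trans (hA _ (lexx _)); rewrite ler_nat; apply: subset_leq_card.
apply/subsetP => x; rewrite !inE => /andP[xr /forallP h]; rewrite xr /=.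
by apply/subsetP => y /imsetP[r _ ->]; rewrite di.
Qed.
End PatternSample.

(** * The popular difference density *)

Require Import Defs.
From mathcomp Require Import all_boot all_order all_algebra finmap.
From mathcomp Require Import all_classical all_reals.

Import Order.TTheory GRing.Theory Num.Theory.
Local Open Scope ring_scope.

Lemma fset4_sorted (P : {fset int}) : #|` P| = 4%N ->
  exists k0 k1 k2 k3 : int, [/\ P = [fset k0; k1; k2; k3]%fset,
    k0 < k1, k1 < k2 & k2 < k3].
Proof.
move=> P4; pose s := sort <=%R (enum_fset P).
have ss : sorted <%R s.
  rewrite lt_sorted_uniq_le sort_uniq fset_uniq /=.
  by apply: sort_sorted; exact: le_total.
have sz : size s = 4%N by rewrite size_sort -P4.
have mem x : (x \in P) = (x \in s) by rewrite mem_sort.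
case: s ss sz mem => [|k0 [|k1 [|k2 [|k3 [|? ?]]]]] //= /and4P[h1 h2 h3 _] _ mem.
exists k0, k1, k2, k3; split=> //; apply/fsetP => x.
by rewrite mem !inE !orbA.
Qed.

(** ['I_N] starts at 0, the interval of the theorem at 1. *)
Definition shifted_set (N : nat) (A : {set 'I_N}) : {fset int} :=
  [fset ((val x)%:Z + 1)%R | x in A]%fset.

Lemma shifted_setP (N : nat) (A : {set 'I_N}) (y : int) :
  reflect (exists2 x : 'I_N, x \in A & y = x%:Z + 1) (y \in shifted_set A).
Proof.
apply: (iffP idP) => [/imfsetP[x xA ->]|[x xA ->]]; first by exists x.
by apply/imfsetP; exists x.
Qed.

Lemma card_shifted_set (N : nat) (A : {set 'I_N}) : #|` shifted_set A| = #|A|.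
Proof.
rewrite card_imfset /=; last by move=> x y /addIr [] /val_inj.
by rewrite -cardE.
Qed.

(** A translate [x] corresponds to the starting point [x + d * k0 - 1] of a pattern normalised to
    begin at 0. *)
Lemma ntranslates_le_occurrences (k0 k1 k2 k3 d : int) (K' L : nat)
    (A : {set 'I_(K'.+1 * L)}) :
  (ntranslates [fset k0; k1; k2; k3]%fset (shifted_set A) d <=
   #|occurrences (k1 - k0) (k2 - k0) (k3 - k0) A d|)%N.
Proof.
set P := [fset k0; k1; k2; k3]%fset.
have P0 : P != fset0 by apply/fset0Pn; exists k0; rewrite !inE eqxx.
have Pin : [/\ k0 \in P, k1 \in P, k2 \in P & k3 \in P].
  by rewrite !inE !eqxx !orbT.
set O := occurrences _ _ _ _ _.
apply: (@leq_trans #|` [fset ((val x)%:Z + 1 - d * k0)%R | x in O]%fset|); last first.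
  by apply: leq_trans (leq_imfset_card _ _ _) _; rewrite /= -cardE.
apply: fsubset_leq_card; apply/fsubsetP => x.
rewrite in_fset_set ?inE; last exact: finite_translates.
move=> tr.
have memP (r : 'I_4) : k0 + pattern_pt 0 (k1 - k0) (k2 - k0) (k3 - k0) r \in P.
  case: Pin => p0 p1 p2 p3; case: r => [[|[|[|[|//]]]] ?]; rewrite /pattern_pt /=.
  - by rewrite addr0.
  - by rewrite addrC subrK.
  - by rewrite addrC subrK.
  - by rewrite addrC subrK.
have tr' : forall y, y \in P -> x + d * y \in shifted_set A by exact: tr.
have [u uA xu] := @shifted_setP _ _ _ (tr' _ (memP ord0)).
rewrite /pattern_pt /= addr0 in xu.
have step (r : 'I_4) : exists2 v : 'I_(K'.+1 * L), v \in A &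
    u%:Z + d * pattern_pt 0 (k1 - k0) (k2 - k0) (k3 - k0) r = v%:Z.
  have [v vA xv] := @shifted_setP _ _ _ (tr' _ (memP r)); exists v => //.
  apply: (addIr 1); rewrite -xv mulrDr addrA xu; ring.
have ur : u \in in_range (k1 - k0) (k2 - k0) (k3 - k0) K' L d.
  rewrite inE; apply/forallP => r; have [v _ ->] := step r.
  by rewrite ltz_nat ltn_ord.
apply/imfsetP; exists u => /=; last by rewrite -xu addrK.
rewrite inE ur /=; apply/forallP => r; have [v vA uv] := step r.
suff -> : place (k1 - k0) (k2 - k0) (k3 - k0) d u r = v by [].
by apply: val_inj; apply/eqP; rewrite -eqz_nat placeE // uv.
Qed.

(** The quadratic term of the exponential series already outgrows a linear function of [N]. *)
Lemma exp_dominates (R : realType) (rho : R) (c : nat) : 0 < rho ->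
  exists N1 : nat, forall N : nat, (N1 <= N)%N ->
    (2 * N * c + 1)%:R <= expR (rho ^+ 2 * N%:R).
Proof.
move=> rho0; have r40 : 0 < rho ^+ 4 by rewrite exprn_gt0.
exists (Num.bound (4 * c%:R / rho ^+ 4)) => N hN.
have cN : 4 * c%:R <= rho ^+ 4 * N%:R.
  rewrite [leRHS]mulrC -ler_pdivrMr //; apply: le_trans (ltW (archi_boundP _)) _.
    by apply: divr_ge0; [exact: mulr_ge0 | exact: ltW].
  by rewrite ler_nat.
apply: le_trans (expR_ge1Dxn 1 _); last by rewrite mulr_ge0 ?exprn_ge0 ?(ltW rho0).
rewrite natrD addrC lerD2l.
apply: (@le_trans _ _ (N%:R * (rho ^+ 4 * N%:R) / 2)); last first.
  rewrite le_eqVlt; apply/orP; left; apply/eqP.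
  have -> : (1.+1)`!%:R = 2 :> R by [].
  by field.
have : 0 <= N%:R * (rho ^+ 4 * N%:R - 4 * c%:R) by rewrite mulr_ge0 // subr_ge0.
by rewrite !natrM mulrBr; lra.
Qed.

(** The sum is at most [1 - 15 t / 16] times [N], the factor [(1 + dlt1) ^+ 4 <= 1 + t / 4] raises
    this to [1 - 11 t / 16], and sampling adds [t / 16], which stays below [1 - t / 2]. *)
Lemma final_constants (R : realType) (alpha t dlt1 rho c S N : R) :
  0 < alpha -> 0 < t -> t <= 1 / 2 -> 0 < dlt1 -> dlt1 <= t / 60 -> 0 < N ->
  c * (2 * rho) <= alpha ^+ 4 * t / 16 ->
  S <= (1 - t + dlt1 / 4) * N ->
  (alpha * (1 + dlt1)) ^+ 4 * S + c * (2 * rho * N) < (1 - t / 2) * alpha ^+ 4 * N.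
Proof.
move=> a0 t0 t1 d0 d1 N0 hc hS.
have a40 : 0 < alpha ^+ 4 by rewrite exprn_gt0.
have pow : (1 + dlt1) ^+ 4 <= 1 + t / 4.
  have W2 : dlt1 ^+ 2 <= dlt1 by rewrite expr2; nra.
  have W3 : dlt1 ^+ 3 <= dlt1 by rewrite exprS; nra.
  have W4 : dlt1 ^+ 4 <= dlt1 by rewrite exprS; nra.
  have -> : (1 + dlt1) ^+ 4 =
    1 + 4 * dlt1 + 6 * dlt1 ^+ 2 + 4 * dlt1 ^+ 3 + dlt1 ^+ 4 by ring.
  lra.
have S1 : S <= (1 - 15 / 16 * t) * N by nra.
have p0 : 0 <= (1 + dlt1) ^+ 4 by rewrite exprn_ge0 //; lra.
have S2 : (1 + dlt1) ^+ 4 * S <= (1 - 11 / 16 * t) * N.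
  apply: (@le_trans _ _ ((1 + dlt1) ^+ 4 * ((1 - 15 / 16 * t) * N))).
    by rewrite ler_wpM2l.
  apply: (@le_trans _ _ ((1 + t / 4) * ((1 - 15 / 16 * t) * N))).
    by rewrite ler_wpM2r // mulr_ge0 ?(ltW N0) //; lra.
  rewrite mulrA ler_wpM2r ?(ltW N0) //; nra.
rewrite exprMn -mulrA.
have S3 : alpha ^+ 4 * ((1 + dlt1) ^+ 4 * S) <= alpha ^+ 4 * ((1 - 11 / 16 * t) * N).
  by rewrite ler_pM2l.
have S4 : c * (2 * rho * N) <= alpha ^+ 4 * t / 16 * N.
  by rewrite mulrA ler_wpM2r // ltW.
have pos : 0 < alpha ^+ 4 * t * N by rewrite !mulr_gt0.
lra.
Qed.

Theorem theorem1p6 (R : realType) :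
  exists c : R, 0 < c /\
  forall P : {fset int}, #|` P| = 4%N ->
  ~ (exists k0 k1 k2 k3 : int,
       [/\ P = [fset k0; k1; k2; k3]%fset, k0 < k1, k1 < k2, k2 < k3
         & k0 + k3 = k1 + k2]) ->
  forall alpha : R, 0 < alpha -> alpha < 1 / 2 ->
  pdd P alpha < (1 - c) * alpha ^+ 4.
Proof.
have [K' QD] := quadratic_density R.
pose t : R := (2 * K'.+1%:R)^-1.
have K1 : 1 <= K'.+1%:R :> R by rewrite ler1n.
have t0 : 0 < t by rewrite invr_gt0; lra.
have t1 : t <= 1 / 2 by rewrite /t mul1r lef_pV2 ?posrE; lra.
(* Half of the saving [t] pays for the errors in [final_constants], and a quarter is the [eps] in
   the definition of [pdd]. *)
exists (t / 4); split; first by rewrite divr_gt0.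
move=> P P4 notpar alpha a0 a12.
have [k0 [k1 [k2 [k3 [PE k01 k12 k23]]]]] := fset4_sorted P4.
have np : 0 + (k3 - k0) != (k1 - k0) + (k2 - k0).
  apply/eqP => e; apply: notpar; exists k0, k1, k2, k3; split=> //.
  by move: e; clear; lia.
have a40 : 0 < alpha ^+ 4 by rewrite exprn_gt0.
rewrite ltNge; apply/negP => le_pdd.
have P0 : P != fset0 by rewrite -cardfs_gt0 P4.
have [|popular _] := pddP (P := P) (alpha := alpha) P0; first by lra.
have eps0 : 0 < t / 4 * alpha ^+ 4 by rewrite mulr_gt0 ?divr_gt0.
have [N0 hN0] := popular _ eps0.
(* Raising the density by [1 + dlt1] pays for the losses in the mean and in the sampling. The second
   bound, positive because [alpha < 1 / 2], keeps the density at most 1 although [f0] may reach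
   2. *)
pose dlt1 : R := Num.min (t / 60) ((2 * alpha)^-1 - 1).
have d10 : 0 < dlt1.
  rewrite lt_min; apply/andP; split; first by lra.
  by rewrite subr_gt0 invf_gt1; lra.
have d1t : dlt1 <= t / 60 by rewrite ge_min lexx.
have d1a : alpha * (1 + dlt1) <= 1 / 2.
  have : dlt1 <= (2 * alpha)^-1 - 1 by rewrite ge_min lexx orbT.
  rewrite lerBrDr addrC => h.
  apply: (@le_trans _ _ (alpha * (2 * alpha)^-1)); first by rewrite ler_pM2l.
  by rewrite le_eqVlt; apply/orP; left; apply/eqP; field; rewrite gt_eqF.
pose c : R := (`|k3 - k0|.+1)%:R.
have c1 : 1 <= c by rewrite ler1n.
(* The three bounds serve the size of [A], the number of patterns and the hypothesis of
   [pattern_sample], in this order. *)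
pose rho : R := Num.min (Num.min (alpha * dlt1 / 6) (alpha ^+ 4 * t / (32 * c))) (1 / 2).
have rho0 : 0 < rho.
  have c0 : 0 < 32 * c by lra.
  rewrite !lt_min; apply/andP; split; last by lra.
  by apply/andP; split; [rewrite divr_gt0 ?mulr_gt0 | rewrite divr_gt0 ?mulr_gt0].
have rho1 : rho <= 1 / 2 by rewrite ge_min lexx orbT.
have rho2 : rho <= alpha * dlt1 / 6 by rewrite !ge_min lexx.
have rho3 : c * (2 * rho) <= alpha ^+ 4 * t / 16.
  have h : rho <= alpha ^+ 4 * t / (32 * c) by rewrite !ge_min lexx orbT.
  have c0 : 0 < 32 * c by lra.
  by move: h; rewrite ler_pdivlMr //; lra.
have kk : [/\ 0 < k1 - k0, k1 - k0 < k2 - k0 & k2 - k0 < k3 - k0].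
  by rewrite subr_gt0 !ltrD2r.
case: kk => g1 g2 g3.
have d140 : 0 < dlt1 / 4 by rewrite divr_gt0.
have [L0 hL] := QD _ _ _ g1 g2 g3 np _ d140.
have [N1 hN1] := @exp_dominates R rho (`|k3 - k0|.+1) rho0.
pose L := (L0 + N0 + N1).+1; pose N := (K'.+1 * L)%N.
have LN : (L <= N)%N by rewrite leq_pmull.
have LL0 : (L0 <= L)%N := leq_trans (leq_trans (leq_addr _ _) (leq_addr _ _)) (leqnSn _).
have LN0 : (N0 <= L)%N := leq_trans (leq_trans (leq_addl _ _) (leq_addr _ _)) (leqnSn _).
have LN1 : (N1 <= L)%N := leq_trans (leq_addl _ _) (leqnSn _).
have [f0 [f02 meanf0 countf0]] := hL L LL0.
have NR : 0 < N%:R :> R by rewrite ltr0n muln_gt0.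
pose f p := alpha * (1 + dlt1) * f0 p.
have s0 : 0 < alpha * (1 + dlt1) by rewrite mulr_gt0 //; lra.
have f01 p : 0 <= f p <= 1.
  have /andP[h0 h2] := f02 p; rewrite /f mulr_ge0 ?(ltW s0) //=.
  apply: (@le_trans _ _ (1 / 2 * 2)); last by lra.
  by apply: ler_pM => //; exact: ltW.
have [|A [sizeA hitA]] := pattern_sample (K' := K') (L := L) g1 g2 g3 f01 rho0 rho1.
  exact: hN1 (leq_trans LN1 LN).
have [|a /shifted_setP[x _ ->]||d [d0 hd]] := hN0 N _ (shifted_set A).
- exact: leq_trans LN0 LN.
- by rewrite -[1]/(1%:Z) -PoszD !lez_nat addn1 ltn_ord.
- rewrite card_shifted_set; apply: le_trans sizeA.
  rewrite /f -mulr_sumr -/N lerBrDr.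
  apply: (@le_trans _ _ (alpha * (1 + dlt1) * ((1 - dlt1 / 4) * N%:R))); last first.
    by rewrite ler_pM2l.
  have h1 : 3 * rho * N%:R <= alpha * dlt1 / 2 * N%:R.
    by rewrite ler_wpM2r ?(ltW NR) //; lra.
  have h2 : (1 + dlt1 / 2) <= (1 + dlt1) * (1 - dlt1 / 4) by nra.
  have h3 : alpha * N%:R * (1 + dlt1 / 2) <= alpha * N%:R * ((1 + dlt1) * (1 - dlt1 / 4)).
    by rewrite ler_pM2l // mulr_gt0.
  lra.
have cnt : (ntranslates P (shifted_set A) d)%:R <=
    (#|occurrences (k1 - k0) (k2 - k0) (k3 - k0) A d|)%:R :> R.
  by rewrite PE ler_nat; exact: ntranslates_le_occurrences.
have low : (1 - t / 2) * alpha ^+ 4 * N%:R <= (ntranslates P (shifted_set A) d)%:R.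
  apply: le_trans hd; rewrite ler_pM2r //; lra.
have pos : 0 < (1 - t / 2) * alpha ^+ 4 * N%:R by rewrite !mulr_gt0 //; lra.
(* Differences of absolute value at least [N] admit no pattern inside the interval, against the
   positive lower bound [low]. *)
have [dN|dN] := lerP N%:Z `|d|.
  have rng0 := in_range_far (K' := K') (L := L) g1 g2 g3 dN.
  have occ0 : #|occurrences (k1 - k0) (k2 - k0) (k3 - k0) A d| = 0%N.
    by apply/eqP; rewrite cards_eq0 /occurrences rng0; apply/eqP/setP => x; rewrite !inE.
  by move: cnt; rewrite occ0; lra.
have S := countf0 d d0 dN; have H := hitA d d0 dN.
have E : \sum_(x in in_range (k1 - k0) (k2 - k0) (k3 - k0) K' L d)
     \prod_(r < 4) f (x%:Z + d * pattern_pt 0 (k1 - k0) (k2 - k0) (k3 - k0) r) =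
   (alpha * (1 + dlt1)) ^+ 4 *
   \sum_(x in in_range (k1 - k0) (k2 - k0) (k3 - k0) K' L d)
     \prod_(r < 4) f0 (x%:Z + d * pattern_pt 0 (k1 - k0) (k2 - k0) (k3 - k0) r).
  rewrite mulr_sumr; apply: eq_bigr => x _.
  by rewrite /f big_split /= prodr_const card_ord.
have F := @final_constants R alpha t dlt1 rho c _ N%:R a0 t0 t1 d10 d1t NR rho3 S.
have := lt_le_trans F low; rewrite ltNge => /negP; apply.
by apply: le_trans cnt _; rewrite -E.
Qed.
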